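(* $\ell_\infty$ is Borel reducible to $\cong_u$, the relation of uniform homeomorphism on the space $\mathcal{T}$ of pruned trees on $\mathbb{N}$. Consequently, $\cong_u$ is not Borel reducible to any orbit equivalence relation induced by a Borel action of a Polish group; in particular, $\cong_u$ is not Borel reducible to $\mathrm{GI}$.
   Context: A tree on $\mathbb{N}$ is a nonempty $T\subseteq\mathbb{N}^{<\mathbb{N}}$ closed under initial segments; it is pruned if every $s\in T$ has a proper extension in $T$. $\mathcal{T}\subseteq 2^{(\mathbb{N}^{<\mathbb{N}})}$ is the standard Borel space of pruned trees. $[T]=\{x\in\mathbb{N}^{\mathbb{N}}:\forall n\ x\upharpoonright n\in T\}$ with ultrametric $d(x,y)=2^{-n}$ for $x\neq y$, $n$ least with $x(n)\neq y(n)$. $T\cong_u S$ iff there is a bijection $[T]\to[S]$ which together with its inverse is uniformly continuous. $\ell_\infty$ on $\mathbb{R}^{\mathbb{N}}$: $(x_n)\,\ell_\infty\,(y_n)$ iff $\exists M\in\mathbb{R}\ \forall n\ |x_n-y_n|<M$. $\mathrm{GI}$ is isomorphism of countable graphs on vertex set $\mathbb{N}$. *)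

(* Defs.v *)
From HB Require Import structures.
From mathcomp Require Import all_boot all_order all_algebra.
From mathcomp Require Import all_classical all_reals all_analysis.

Set Implicit Arguments.
Unset Strict Implicit.
Unset Printing Implicit Defensive.

Import Order.TTheory GRing.Theory Num.Theory.
Import numFieldNormedType.Exports.

Local Open Scope classical_set_scope.
Local Open Scope ring_scope.

(* [measurableType] and [g_sigma_algebraType] need a distinguished point, so
   the sigma-algebra generated by the open sets is used directly. *)
Definition borel_set (X : topologicalType) : set_system X := <<s @open X >>.

Definition borel_fun (X Y : topologicalType) (f : X -> Y) : Prop :=
  forall B : set Y, borel_set B -> borel_set (f @^-1` B).

Definition borel_reducible (X Y : topologicalType)
    (E : X -> X -> Prop) (F : Y -> Y -> Prop) : Prop :=
  exists2 f : X -> Y, borel_fun f & forall x y, E x y <-> F (f x) (f y).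

Section polish.
Context (R : realType) (X : topologicalType).
Implicit Type d : X -> X -> R.

Definition is_distance d : Prop :=
  [/\ forall x y, 0 <= d x y,
      forall x y, d x y = 0 <-> x = y,
      forall x y, d x y = d y x
    & forall x y z, d x z <= d x y + d y z].

Definition distance_compatible d : Prop :=
  forall (x : X) (A : set X),
    nbhs x A <-> exists2 e : R, 0 < e & [set y | d x y < e] `<=` A.

Definition distance_complete d : Prop :=
  forall u : nat -> X,
    (forall e : R, 0 < e ->
       exists N, forall m n, (N <= m)%N -> (N <= n)%N -> d (u m) (u n) < e) ->
    exists l : X, u @ \oo --> l.

Definition polish_space : Prop :=
  (exists2 D : set X, countable D & dense D) /\
  exists d, [/\ is_distance d, distance_compatible d & distance_complete d].

End polish.

HB.mixin Record isTopologicalGroup G & Topological G & Group G := {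
  mulg_continuous : continuous (fun gh : G * G => (gh.1 * gh.2)%g) ;
  invg_continuous : continuous (fun g : G => (g^-1)%g)
}.

#[short(type="topologicalGroupType")]
HB.structure Definition TopologicalGroup :=
  {G of Topological G & Group G & isTopologicalGroup G}.

Definition is_group_action (G : groupType) (X : Type) (act : G -> X -> X) :
    Prop :=
  (forall x, act 1%g x = x) /\
  (forall g h x, act (g * h)%g x = act g (act h x)).

(* A standard Borel space is given here by a Polish topology generating its
   sigma-algebra; for Polish [G] and [X] the Borel sets of the product topology
   on [G * X] form the product sigma-algebra. *)
Definition borel_action (G : topologicalGroupType) (X : topologicalType)
    (act : G -> X -> X) : Prop :=
  is_group_action act /\ borel_fun (fun gx : G * X => act gx.1 gx.2).

Definition orbit_equiv (G : groupType) (X : Type) (act : G -> X -> X) :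
    X -> X -> Prop :=
  fun x y => exists g : G, act g x = y.

Definition real_sequences (R : realType) : topologicalType := {ptws nat -> R}.

Definition linfty_equiv (R : realType) :
    real_sequences R -> real_sequences R -> Prop :=
  fun x y : {ptws nat -> R} => exists M : R, forall n, `|x n - y n| < M.

Definition is_tree (T : seq nat -> bool) : Prop :=
  (exists s, T s) /\ (forall s t, prefix s t -> T t -> T s).

Definition is_pruned (T : seq nat -> bool) : Prop :=
  forall s, T s -> exists t, [/\ T t, prefix s t & s != t].

(* As a type, [pruned_trees] carries the topology induced by 2^(N^{<N}). *)
Definition pruned_trees : set {ptws seq nat -> bool} :=
  [set T | is_tree T /\ is_pruned T].

(* The phantom parameter [R] is the codomain of the distance. *)
Definition baire (R : realType) : Type := nat -> nat.

HB.instance Definition _ (R : realType) := gen_eqMixin (baire R).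
HB.instance Definition _ (R : realType) := gen_choiceMixin (baire R).

Definition baire_dist (R : realType) (x y : baire R) : R :=
  if pselect (exists n, x n != y n) is left xy then 2 ^- (ex_minn xy) else 0.

Section baire_metric.
Context (R : realType).
Implicit Types x y z : baire R.

Lemma baire_distxx x : baire_dist x x = 0.
Proof.
by rewrite /baire_dist; case: pselect => // xx; have [n /eqP] := xx.
Qed.

Lemma baire_dist_positivity x y : baire_dist x y = 0 -> x = y.
Proof.
rewrite /baire_dist; case: pselect => [xy /eqP|xy _].
  by rewrite invr_eq0 expf_eq0 pnatr_eq0 andbF.
by apply/funext => n; apply/eqP; apply: contra_notT xy => xyn; exists n.
Qed.

Lemma baire_dist_sym x y : baire_dist x y = baire_dist y x.
Proof.
rewrite /baire_dist; case: pselect => [xy|xy]; case: pselect => [yx|yx] //.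
- case: ex_minnP => m xm mP; case: ex_minnP => n yn nP.
  suff -> : m = n by [].
  by apply/eqP; rewrite eqn_leq mP 1?eq_sym// nP// eq_sym.
- by exfalso; apply: yx; case: xy => n xyn; exists n; rewrite eq_sym.
- by exfalso; apply: xy; case: yx => n yxn; exists n; rewrite eq_sym.
Qed.

Lemma baire_dist_ge0 x y : 0 <= baire_dist x y.
Proof. by rewrite /baire_dist; case: pselect. Qed.

Lemma baire_dist_ge n x y : x n != y n -> 2 ^- n <= baire_dist x y.
Proof.
move=> xyn; rewrite /baire_dist; case: pselect => [xy|]; last by case; exists n.
case: ex_minnP => m _ /(_ _ xyn) mn.
by rewrite lef_pV2 ?posrE ?exprn_gt0// ler_eXn2l// ltr1n.
Qed.

Lemma baire_dist_triangle y x z :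
  baire_dist x z <= baire_dist x y + baire_dist y z.
Proof.
rewrite {1}/baire_dist; case: pselect => [xz|_]; last first.
  by rewrite addr_ge0 ?baire_dist_ge0.
case: ex_minnP => n xzn _; have [xy|xy] := eqVneq (x n) (y n).
  have yzn : y n != z n by rewrite -xy.
  by rewrite (le_trans (baire_dist_ge yzn))// lerDr baire_dist_ge0.
by rewrite (le_trans (baire_dist_ge xy))// lerDl baire_dist_ge0.
Qed.

End baire_metric.

HB.instance Definition _ (R : realType) := @isMetric.Build R (baire R)
  (@baire_dist R) (@baire_distxx R) (@baire_dist_positivity R)
  (@baire_dist_sym R) (@baire_dist_triangle R).

Definition body (R : realType) (T : seq nat -> bool) : set (baire R) :=
  [set x | forall n, T (mkseq x n)].
Arguments body : clear implicits.

(* [body R T] as a type carries the uniformity induced by [baire_dist]. *)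
Definition unif_homeomorphic (R : realType) :
    pruned_trees -> pruned_trees -> Prop :=
  fun T S =>
    exists (f : body R (\val T) -> body R (\val S))
           (g : body R (\val S) -> body R (\val T)),
      [/\ cancel f g, cancel g f, unif_continuous f & unif_continuous g].

Definition countable_graphs : set {ptws (nat * nat)%type -> bool} :=
  [set e | (forall i, ~~ e (i, i)) /\ (forall i j, e (i, j) = e (j, i))].

Definition graph_iso : countable_graphs -> countable_graphs -> Prop :=
  fun e1 e2 => exists2 f : nat -> nat, bijective f &
    forall i j, \val e1 (i, j) = \val e2 (f i, f j).

(* Main.v *)
From HB Require Import structures.
Require Import Defs.
From mathcomp Require Import all_boot all_order all_algebra.
From mathcomp Require Import all_classical all_reals all_analysis.
From mathcomp Require Import lra zify.

(** Given [c : nat -> nat], the tree [ctree c] consists, for each [p], of a stem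
    of length [c p] carrying two blocks numbered [2 p] and [2 p + 1].  Block [q]
    has a base point 0^oo which is a limit both of points of a perfect set and
    of scattered points of every Cantor-Bendixson rank up to [q], but no higher;
    this makes the base point of block [q] the only point of the body in
    [cl E_q \ (E_q u cl E_(q+1))], where [E_k] is the set of points of rank [k].
    Every homeomorphism between two bodies thus preserves the base points, and
    the two base points over [p] are at distance about 2^-(c p), so that the
    bodies for [c] and [c'] are uniformly homeomorphic iff [c] and [c'] tend to
    infinity along the same sequences of indices.  With
    [c (n, i) = |floor (x n) - i|] this says that the two real sequences are at
    bounded distance.

    For the second part it suffices that [E1], equality of all but finitely many
    rows on (2^N)^N, reduces to l_oo but not to an orbit equivalence relation
    (Kechris and Louveau).  Let [f] be a Borel reduction of [E1] to the orbit
    relation of [G].  The map [F (y, h) = h f(y)] is continuous on a comeager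
    set.  Covering [G] by countably many translates of a neighbourhood of 1 and
    using the Baire property of analytic sets, one sees that for generic [y] a
    generic small change of a row of [y] moves [f(y)] by a small element of [G].
    Changing all rows in turn one gets [y_n -> y] and a convergent sequence
    [k_n -> k] with [k_n f(y_n) = f(y_0)].  For generic [h], [F (y_n, h k_n)] is
    constant and [F] is continuous at [(y, h k)], so [f(y)] is in the orbit of
    [f(y_0)], although [y] and [y_0] differ in every row. *)

Set Implicit Arguments.
Unset Strict Implicit.
Unset Printing Implicit Defensive.

Import Order.TTheory GRing.Theory Num.Theory.
Import numFieldNormedType.Exports.

Local Open Scope classical_set_scope.
Local Open Scope ring_scope.

(** * Baire category *)

Definition countable_base (X : topologicalType) (b : nat -> set X) : Prop :=
  (forall k, open (b k)) /\
  forall x V, nbhs x V -> exists2 k, b k x & b k `<=` V.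

Lemma sub_interior (X : topologicalType) (W A : set X) :
  open W -> W `<=` A -> W `<=` interior A.
Proof. by move=> oW WA; rewrite -open_subsetE. Qed.

Lemma openX (X Y : topologicalType) (A : set X) (B : set Y) :
  open A -> open B -> open (A `*` B).
Proof.
move=> oA oB; rewrite openE => -[x y] [/= Ax By].
by exists (A, B) => //; split; exact: open_nbhs_nbhs.
Qed.

Lemma fst_continuous (X Y : topologicalType) : continuous (@fst X Y).
Proof. by move=> p; exact: cvg_fst. Qed.

Lemma snd_continuous (X Y : topologicalType) : continuous (@snd X Y).
Proof. by move=> p; exact: cvg_snd. Qed.

Lemma continuous_compT (X Y Z : topologicalType) (f : X -> Y) (g : Y -> Z) :
  continuous f -> continuous g -> continuous (g \o f).
Proof. by move=> cf cg x; apply: continuous_comp; [exact: cf|exact: cg]. Qed.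

Lemma continuous_pair (X Y Z : topologicalType) (f : X -> Y) (g : X -> Z) :
  continuous f -> continuous g -> continuous (fun x => (f x, g x)).
Proof.
move=> cf cg x V [[P Q] /= [Px Qx] PQV]; rewrite nbhs_simpl /=.
have Pf : nbhs x (f @^-1` P) by exact: cf.
have Qg : nbhs x (g @^-1` Q) by exact: cg.
by apply: filterS (filterI Pf Qg) => z [/= Pz Qz]; exact: PQV.
Qed.

Section comeager.
Context (X : topologicalType).
Implicit Types (A B V : set X).

Definition comeager A : Prop :=
  exists2 O : nat -> set X,
    (forall n, open (O n) /\ dense (O n)) & \bigcap_n O n `<=` A.

Lemma comeagerS A B : A `<=` B -> comeager A -> comeager B.
Proof. by move=> AB [ O Oo OA]; exists O => // x /OA /AB. Qed.

Lemma open_dense_comeager A : open A -> dense A -> comeager A.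
Proof. by move=> oA dA; exists (fun=> A) => // x /(_ 0 I). Qed.

Lemma denseT : dense [set: X].
Proof. by move=> O [x Ox] _; exists x. Qed.

Lemma comeagerT : comeager setT.
Proof. exact: open_dense_comeager openT denseT. Qed.

Lemma comeager_forall (J : countType) (A : J -> set X) :
  (forall i, comeager (A i)) -> comeager [set x | forall i, A i x].
Proof.
move=> cA.
have /choice[ O OP] : forall i, exists O : nat -> set X,
    (forall n, open (O n) /\ dense (O n)) /\ \bigcap_n O n `<=` A i.
  by move=> i; have [ O ? ?] := cA i; exists O.
(* The dense open sets of all the [A i] are merged into one sequence; a number coding no pair
   contributes the whole space. *)
exists (fun k => if unpickle k is Some ij then O ij.1 ij.2 else setT).
  move=> n; case: (unpickle n) => [[i j]|]; last by split;
    [exact: openT|exact: denseT].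
  by have [+ _] := OP i; exact.
move=> x Ox i; have [_] := OP i; apply => j _.
by have := Ox (pickle (i, j)) I; rewrite pickleK.
Qed.

Lemma comeagerI A B : comeager A -> comeager B -> comeager (A `&` B).
Proof.
move=> cA cB; apply: (@comeagerS [set x | forall b : bool, (if b then A else B)
  x]).
  by move=> x AB; split; [exact: (AB true)|exact: (AB false)].
by apply: comeager_forall => -[].
Qed.

(** Density of [A] within [V] suffices: [A] together with the exterior of [V] is open and dense, and
    the implication holds on it. *)
Lemma dense_imply_open V A : open V -> open A ->
  (forall W, open W -> W `<=` V -> W !=set0 -> W `&` A !=set0) ->
  comeager [set x | V x -> A x].
Proof.
move=> oV oA VA.
apply: (@comeagerS (A `|` interior (~` V))).
  by move=> x [Ax _ //|/interior_subset nV /nV].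
apply: open_dense_comeager; first exact: openU oA (open_interior _).
move=> W W0 oW; have [[x [Wx Vx]]|WV] := pselect (W `&` V !=set0).
  have [] := VA (W `&` V) (openI oW oV) (@subIsetr _ _ _); first by exists x.
  by move=> y [[Wy _] Ay]; exists y; split => //; left.
case: W0 => x Wx; exists x; split => //; right.
apply: (sub_interior oW) Wx => y Wy Vy; apply: WV; by exists y.
Qed.

(** The complement is the boundary of [V], nowhere dense because [V] is open. *)
Lemma comeager_setU_interiorC V : open V -> comeager (V `|` interior (~` V)).
Proof.
move=> oV; apply: open_dense_comeager; first exact: openU oV (open_interior _).
move=> W [x Wx] oW; have [[y [Wy Vy]]|WV] := pselect (W `&` V !=set0).
  by exists y; split => //; left.
exists x; split => //; right.
by apply: (sub_interior oW) Wx => y Wy Vy; apply: WV; exists y.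
Qed.

End comeager.

(** * Comeager sets under open maps and in products *)

Section comeager_maps.
Context (X Y : topologicalType).

Definition open_map (f : X -> Y) : Prop :=
  forall (V : set X), open V -> open (f @` V).

Lemma open_mapP (f : X -> Y) :
  (forall x (V : set X), nbhs x V -> nbhs (f x) (f @` V)) -> open_map f.
Proof.
by move=> fV V; rewrite !openE => oV _ [x Vx <-]; apply: fV; exact: oV.
Qed.

Lemma comeager_preimage (f : X -> Y) (A : set Y) :
  continuous f -> open_map f -> comeager A -> comeager (f @^-1` A).
Proof.
move=> cf of_ [ O OP OA]; exists (fun n => f @^-1` O n).
  move=> n; have [oO dO] := OP n; split; first by move/continuousP: cf; apply.
  move=> V [x Vx] oV; have [|_ [[z Vz <-] Oz]] := dO _ _ (of_ _ oV).
    by exists (f x); exists x.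
  by exists z.
by move=> x Ox; apply: OA => n _; exact: Ox.
Qed.

(** For nonempty [b k], the points whose section of [O n] meets [b k] form an open dense set, a
    projection. A point passing these countably many tests has dense open sections. *)
Lemma kuratowski_ulam (b : nat -> set Y) (A : set (X * Y)) :
  countable_base b -> comeager A ->
  comeager [set x | comeager [set y | A (x, y)]].
Proof.
move=> [ob bb] [ O OP OA].
pose C (nk : nat * nat) :=
  [set x : X | b nk.2 !=set0 -> exists2 y, b nk.2 y & O nk.1 (x, y)].
have cC : comeager [set x | forall nk, C nk x].
  apply: comeager_forall => -[n k]; have [oO dO] := OP n.
  have [b0|nb0] := pselect (b k !=set0); last first.
    by apply: comeagerS (@comeagerT _) => x _ /nb0.
  apply: (@comeagerS _ (fst @` (O n `&` (setT `*` b k)))).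
    by move=> _ [[x y] [Oxy [_ bky]] <-] _; exists y.
  apply: open_dense_comeager.
    apply: fst_open; apply: openI => //.
    by apply: openX => //; exact: openT.
  move=> V [x Vx] oV; have [y by_] := b0.
  have [||[x' y'] [[/= Vx' by'] Oxy']] := dO (V `*` b k).
  - by exists (x, y).
  - exact: openX.
  - by exists x'; split => //; exists (x', y').
apply: comeagerS cC => x Cx; exists (fun n => [set y | O n (x, y)]).
  move=> n; have [oO _] := OP n; split.
    rewrite openE => y Oy; move: oO;
      rewrite openE => /(_ _ Oy) [[P Q] [/= Px Qy] PQ].
    by apply: filterS Qy => z Qz; apply: PQ; split => //=;
      exact: nbhs_singleton.
  move=> V [y Vy] oV; have [k bky bV] := bb _ _ (open_nbhs_nbhs (conj oV Vy)).
  have [|z bz Oz] := Cx (n, k); first by exists y.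
  by exists z; split => //; exact: bV.
by move=> y Oy; apply: OA => n _; exact: Oy.
Qed.

End comeager_maps.

(** * The Baire property and open hulls *)

Section baire_property.
Context (X : topologicalType).
Implicit Types A B V : set X.

Definition baire_prop A : Prop :=
  exists2 O, open O & comeager [set x | A x <-> O x].

Lemma baire_prop_ext A B :
  comeager [set x | A x <-> B x] -> baire_prop B -> baire_prop A.
Proof.
move=> cAB [ O oO cO]; exists O => //.
by apply: comeagerS (comeagerI cAB cO) => x [AB BO]; exact: iff_trans AB BO.
Qed.

Lemma open_baire_prop A : open A -> baire_prop A.
Proof. by move=> oA; exists A => //; apply: comeagerS (@comeagerT _). Qed.

Lemma baire_propC A : baire_prop A -> baire_prop (~` A).
Proof.
move=> [ O oO cO]; exists (interior (~` O)); first exact: open_interior.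
have cB := comeager_setU_interiorC oO.
apply: comeagerS (comeagerI cO cB) => x [AO OB]; split => [nAx|].
  by case: OB => // /AO.
by move=> /interior_subset nO /AO.
Qed.

Lemma baire_prop_bigcup (A : nat -> set X) :
  (forall n, baire_prop (A n)) -> baire_prop (\bigcup_n A n).
Proof.
move=> bA; have /choice[ O OP] : forall n, exists O, open O /\
    comeager [set x | A n x <-> O x].
  by move=> n; have [ O ? ?] := bA n; exists O.
exists (\bigcup_n O n); first by apply: bigcup_open => n _; have [] := OP n.
have := comeager_forall (fun n => (OP n).2); apply: comeagerS => x Ax.
by split=> -[n _] /Ax ?; exists n.
Qed.

Lemma borel_baire_prop A : borel_set A -> baire_prop A.
Proof.
move=> bA; apply: (bA baire_prop); split; last exact: open_baire_prop.
split; first exact/open_baire_prop/open0.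
- by move=> B bB; rewrite setTD; exact: baire_propC.
- exact: baire_prop_bigcup.
Qed.

(** [M] is the union of the basic sets on which [A] is comeager; only countably many meager
    exceptions add up. *)
Lemma comeager_locus (b : nat -> set X) A : countable_base b ->
  exists M, [/\ open M, comeager [set x | M x -> A x] &
    forall V, open V -> comeager [set x | V x -> A x] -> V `<=` M].
Proof.
move=> [ob bb].
exists (\bigcup_(k in [set k | comeager [set x | b k x -> A x]]) b k); split.
- exact: bigcup_open.
- have : comeager [set x | forall k, comeager [set x | b k x -> A x] ->
      b k x -> A x].
    apply: comeager_forall => k.
    have [ck|nck] := pselect (comeager [set x | b k x -> A x]).
      by apply: comeagerS ck => x ? _.
    by apply: comeagerS (@comeagerT _) => x _ /nck.
  by apply: comeagerS => x H [k /= ck bkx]; exact: (H k).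
- move=> V oV cV x Vx; have [k kx kV] := bb _ _ (open_nbhs_nbhs (conj oV Vx)).
  by exists k => //=; apply: comeagerS cV => y VA /kV.
Qed.

(* The open hull of an arbitrary set: the points near which the set is nowhere
   meager.  No definability of the set is needed. *)
Lemma open_hull (b : nat -> set X) A : countable_base b ->
  exists H, [/\ open H, comeager [set x | A x -> H x] &
    forall V, open V -> V `&` H !=set0 -> ~ comeager [set x | V x -> ~ A x]].
Proof.
move=> /(comeager_locus (~` A))[M [oM cM MP]].
exists (interior (~` M)); split; first exact: open_interior.
- have cB := comeager_setU_interiorC oM.
  by apply: comeagerS (comeagerI cM cB) => x [MA [/MA nA /nA//|Hx _ //]].
- by move=> V oV [x [Vx /interior_subset]] + cV; apply; exact: MP cV _ Vx.
Qed.

End baire_property.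

(** * Polish spaces *)

Section polish_based.
Context (R : realType).

Lemma ltr_invS (e : R) : 0 < e -> exists n, n.+1%:R^-1 < e.
Proof.
move=> e0; have [n _ /(_ n (leqnn n))] := near_infty_natSinv_lt (PosNum e0).
by exists n.
Qed.

(** Separability as an enumerated base, the form in which the category arguments use it; empty
    members of the base are allowed. *)
Definition polish_based (X : topologicalType) : Prop :=
  exists (b : nat -> set X) (d : X -> X -> R),
    [/\ countable_base b, is_distance d, distance_compatible d &
        distance_complete d].

Section distance.
Context (X : topologicalType) (d : X -> X -> R).
Hypotheses (dd : is_distance d) (dc : distance_compatible d).

Lemma distancexx x : d x x = 0.
Proof. by have [_ /(_ x x)[_ ->]] := dd. Qed.

Lemma distanceC x y : d x y = d y x.
Proof. by case: dd. Qed.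

Lemma distanceD y x z : d x z <= d x y + d y z.
Proof. by case: dd. Qed.

Lemma open_distance_ball x (e : R) : open [set y | d x y < e].
Proof.
rewrite openE => y /= xy; apply/dc; exists (e - d x y);
  first by rewrite subr_gt0.
by move=> z /= yz; apply: le_lt_trans (distanceD y x z) _; rewrite -ltrBrDl.
Qed.

Lemma nbhs_distance_ball x (e : R) : 0 < e -> nbhs x [set y | d x y < e].
Proof. by move=> e0; apply/dc; exists e. Qed.

Lemma distance_lim (u : nat -> X) (l : X) (e : R) : u @ \oo --> l -> 0 < e ->
  exists N, forall n, (N <= n)%N -> d l (u n) < e.
Proof. by move=> ul e0; have [N _ uN] := ul _ (nbhs_distance_ball l e0);
  exists N. Qed.

Lemma distance_eq x y : (forall e : R, 0 < e -> d x y < e) -> x = y.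
Proof.
move=> xy; have [d0 /(_ x y)[+ _] _ _] := dd; apply.
apply: le_anti; rewrite d0 andbT leNgt; apply/negP => /xy.
by rewrite ltxx.
Qed.

Lemma distance_hausdorff x y : x <> y ->
  exists (V W : set X), [/\ open V, open W, V x, W y & V `&` W = set0].
Proof.
move=> xy; pose e := d x y / 2.
have e0 : 0 < e.
  rewrite divr_gt0// lt_neqAle; have [-> dxy _ _] := dd; rewrite andbT eq_sym.
  by apply/eqP => /dxy.
exists [set z | d x z < e], [set z | d y z < e]; split => /=.
- exact: open_distance_ball.
- exact: open_distance_ball.
- by rewrite distancexx.
- by rewrite distancexx.
- rewrite -subset0 => z [/= xz yz]; have := distanceD z x y.
  by rewrite (distanceC z) leNgt (splitr (d x y)) ltrD.
Qed.

Lemma distance_complete_small (u : nat -> X) : distance_complete d ->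
  (forall n m p, (n < m)%N -> (n < p)%N -> d (u m) (u p) <= n.+1%:R^-1) ->
  exists l : X, u @ \oo --> l.
Proof.
move=> dK uS; apply: dK => e /ltr_invS[N Ne]; exists N.+1 => m n Nm Nn.
exact: le_lt_trans (uS _ _ _ Nm Nn) Ne.
Qed.

End distance.

Lemma polish_space_based (X : topologicalType) :
  polish_space R X -> polish_based X.
Proof.
move=> [[D /countable_injP[f finj] dD] [d [dd dc dK]]].
(* The ball of radius [1/(j + 1)] about the point of [D] with code [i]; injectivity of [f] on [D]
   leaves at most one such centre. *)
pose b k := if unpickle k is Some ij
  then \bigcup_(x in [set x | D x /\ f x = ij.1]) [set y | d x y <
    ij.2.+1%:R^-1]
  else set0.
exists b, d; split => //; split.
  move=> k; rewrite /b; case: unpickle => [[i j]|]; last exact: open0.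
  by apply: bigcup_open => x _; exact: open_distance_ball.
move=> x V /dc[e e0 eV]; have /ltr_invS[j je] : 0 < e / 2 by rewrite divr_gt0.
have [||x' [/= xx' Dx']] := dD [set y | d x y < j.+1%:R^-1].
- by exists x; rewrite /= distancexx.
- exact: open_distance_ball.
exists (pickle (f x', j)); rewrite /b pickleK /=.
  by exists x' => //=; rewrite (distanceC dd).
move=> y [x'' [/= Dx'' /finj]]; rewrite !inE => /(_ Dx'' Dx') -> x'y.
apply: eV => /=; apply: le_lt_trans (distanceD dd x' x y) _.
by rewrite (splitr e) ltrD// (lt_trans _ je).
Qed.

Lemma polish_based_space (X : topologicalType) :
  polish_based X -> polish_space R X.
Proof.
move=> [b [d [[ob bb] dd dc dK]]]; split; last by exists d.
have /choice[q qP] : forall k, exists A : set X, countable A /\ A `<=` b k /\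
    (b k !=set0 -> A !=set0).
  move=> k; have [[x bx]|nb] := pselect (b k !=set0); last first.
    by exists set0; split; [exact: countable0|split].
  exists [set x]; split; first exact: countable1.
  by split=> [_ -> //|_]; exists x.
exists (\bigcup_k q k).
  by apply: bigcup_countable => // k _; have [] := qP k.
move=> V [x Vx] oV; have [k bkx bV] := bb _ _ (open_nbhs_nbhs (conj oV Vx)).
have [_ [qb] []] := qP k; first by exists x.
by move=> y qy; exists y; split; [exact/bV/qb|exists k].
Qed.

Lemma polish_based_prod (X Y : topologicalType) :
  polish_based X -> polish_based Y -> polish_based (X * Y)%type.
Proof.
move=> [b [d [[ob bb] dd dc dK]]] [b' [d' [[ob' bb'] dd' dc' dK']]].
pose b2 k := if unpickle k is Some ij then b ij.1 `*` b' ij.2 else set0.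
pose d2 (p q : X * Y) : R := Num.max (d p.1 q.1) (d' p.2 q.2).
exists b2, d2; split.
- split=> [k|[x y] V [[P Q] /= [Px Qy] PQV]].
    rewrite /b2; case: unpickle => [[i j]|]; last exact: open0.
    exact: openX.
  have [i bix biP] := bb _ _ Px; have [j bjy bjQ] := bb' _ _ Qy.
  exists (pickle (i, j)); rewrite /b2 pickleK //=.
  by move=> [x' y'] [/= ? ?]; apply: PQV; split; [exact: biP|exact: bjQ].
- have [d0 d1 ds dt] := dd; have [d0' d1' ds' dt'] := dd'; split.
  + by move=> x y; rewrite le_max d0.
  + move=> [x y] [x' y']; rewrite /d2 /=; split=> [m0|[-> ->]]; last first.
      by rewrite (distancexx dd) (distancexx dd') maxxx.
    have : d x x' <= 0 /\ d' y y' <= 0.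
      by apply/andP; rewrite -ge_max m0.
    move=> [h h']; congr pair; [apply/d1|apply/d1'].
      by apply: le_anti; rewrite h d0.
    by apply: le_anti; rewrite h' d0'.
  + by move=> x y; rewrite /d2 ds ds'.
  + move=> x y z; rewrite /d2 ge_max; apply/andP; split.
      by apply: le_trans (dt _ y.1 _) _; rewrite lerD// le_max lexx.
    by apply: le_trans (dt' _ y.2 _) _; rewrite lerD// le_max lexx orbT.
- move=> [x y] A; split.
    move=> [[P Q] /= [/dc[e e0 eP] /dc'[e' e0' eQ]] PQA].
    exists (Num.min e e'); first by rewrite lt_min e0.
    move=> [x' y'] /=; rewrite /d2 gt_max !lt_min /=.
    by move=> /andP[/andP[xe _] /andP[_ ye]]; apply: PQA; split;
      [exact: eP|exact: eQ].
  move=> [e e0 eA].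
  exists ([set x' | d x x' < e], [set y' | d' y y' < e]).
    by split; [exact: (nbhs_distance_ball dc)|exact: (nbhs_distance_ball dc')].
  by move=> [x' y'] [/= xe ye]; apply: eA; rewrite /= /d2 gt_max xe ye.
- move=> u uC.
  have [|l ul] := dK (fst \o u).
    move=> e /uC[N uN]; exists N => m n Nm Nn.
    by have := uN m n Nm Nn; rewrite /d2 gt_max => /andP[].
  have [|l' ul'] := dK' (snd \o u).
    move=> e /uC[N uN]; exists N => m n Nm Nn.
    by have := uN m n Nm Nn; rewrite /d2 gt_max => /andP[].
  exists (l, l'); rewrite (_ : u = fun n => ((fst \o u) n, (snd \o u) n)).
    exact: cvg_pair.
  by apply/funext => n; rewrite /= -surjective_pairing.
Qed.

(** Baire category theorem: closed balls shrink inside [U] and the successive [O n], and their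
    centres converge to a common point. *)
Lemma polish_baire (X : topologicalType) (A : set X) :
  polish_based X -> comeager A -> dense A.
Proof.
move=> [_ [d [_ dd dc dK]]] [ O OP OA] U [x0 Ux0] oU.
have [e0 e00 e0U] := (dc x0 U).1 (open_nbhs_nbhs (conj oU Ux0)).
(* A state is a stage, a centre and a radius. The next closed ball lies in the current open ball and
   in the current dense open set. *)
pose T := {t : nat * X * R | 0 < t.2}.
pose r (s t : T) := (val t).1.1 = (val s).1.1.+1 /\
  (val t).2 <= (val s).1.1.+1%:R^-1 / 2 /\
  forall y, d (val t).1.2 y <= (val t).2 ->
    d (val s).1.2 y < (val s).2 /\ O (val s).1.1 y.
have stepr (s : T) : {t | r s t}.
  case: s => [[[n x] e] /= ep]; rewrite /r /=; apply: cid.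
  have [oO dO] := OP n.
  have [||y [/= xy Oy]] := dO [set y | d x y < e].
  - by exists x; rewrite /= distancexx.
  - exact: open_distance_ball.
  have [e1 e1p e1P] := (dc y ([set y | d x y < e] `&` O n)).1
    (open_nbhs_nbhs (conj (openI (open_distance_ball dd dc x e) oO) (conj xy
      Oy))).
  (* Halving [e1] puts the closed ball inside the open one; the second bound makes the centres a
     Cauchy sequence. *)
  pose e2 := Num.min (e1 / 2) (n.+1%:R^-1 / 2).
  have e2p : 0 < e2 by rewrite lt_min !divr_gt0.
  exists (exist _ (n.+1, y, e2) e2p); split => //=; split;
    first by rewrite ge_min lexx orbT.
  move=> z yz; apply: e1P => /=; apply: le_lt_trans yz _.
  by rewrite gt_min ltr_pdivrMr// ltr_pMr// ltr1n.
have [f [f0 fr]] := dependent_choice stepr (exist _ (0%N, x0, e0) e00 : T).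
have fn n : (val (f n)).1.1 = n.
  by elim: n => [|n IH]; rewrite ?f0//; have [-> _] := fr n; rewrite IH.
have ball_le n m : (n <= m)%N ->
    d (val (f n)).1.2 (val (f m)).1.2 <= (val (f n)).2 /\
    forall y, d (val (f m)).1.2 y <= (val (f m)).2 ->
      d (val (f n)).1.2 y <= (val (f n)).2.
  move=> nm; have step y : d (val (f m)).1.2 y <= (val (f m)).2 ->
      d (val (f n)).1.2 y <= (val (f n)).2.
    move: nm => /subnK <-; elim: (m - n)%N => // k IH.
    by have [_ [_ /(_ y) P]] := fr (k + n)%N => /P[/ltW /IH].
  by split => //; apply: step; rewrite distancexx// ltW//; exact: (valP (f m)).
have fe n : (val (f n.+1)).2 <= n.+1%:R^-1 / 2.
  by have [_ []] := fr n; rewrite fn.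
pose u n := (val (f n)).1.2.
have [|l ul] := distance_complete_small (u := u) dK.
  move=> n m p nm np; apply: le_trans (distanceD dd (u n.+1) _ _) _.
  rewrite (distanceC dd (u m)) (splitr n.+1%:R^-1).
  by apply: lerD; apply: le_trans (ball_le _ _ _).1 (fe _).
have fl n : d (u n) l <= (val (f n)).2.
  apply/ler_addgt0Pr => e /(distance_lim dc ul)[N uN].
  have /uN := leq_maxl N n; move: (maxn N n) (leq_maxr N n) => m nm lm.
  apply: le_trans (distanceD dd (u m) _ _) _; apply: lerD;
    first exact: (ball_le _ _ nm).1.
  by rewrite distanceC// ltW.
exists l; split.
  apply: e0U => /=; have [_ [_ /(_ l (fl _))[]]] := fr 0.
  by rewrite f0.
by apply: OA => n _; have [_ [_ /(_ l (fl _))[]]] := fr n; rewrite fn.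
Qed.

Lemma comeager_nonempty (X : topologicalType) (A V : set X) :
  polish_based X -> open V -> V !=set0 -> comeager [set x | V x -> A x] ->
  exists2 x, V x & A x.
Proof.
move=> pX oV V0 /(polish_baire pX)/(_ _ V0 oV) [x [Vx VA]].
by exists x => //; exact: VA.
Qed.

End polish_based.

(** * Analytic sets and Borel functions *)

Section analytic.
Context (R : realType) (Q Z : topologicalType).

(** Supplies the pieces of a Souslin scheme: small sets whose closure stays in a prescribed open
    set. *)
Lemma polish_small_cover (d : Q -> Q -> R) (b : nat -> set Q) (O : set Q)
    (p : Q) (e : R) :
  is_distance d -> distance_compatible d -> countable_base b ->
  open O -> O p -> 0 < e ->
  exists k, [/\ b k p, forall q q', b k q -> b k q' -> d q q' <= e &
    closure (b k) `<=` O].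
Proof.
move=> dd dc [ob bb] oO Op e0.
have [e1 e1p e1P] := (dc p O).1 (open_nbhs_nbhs (conj oO Op)).
pose r := Num.min (e / 2) (e1 / 2).
have r0 : 0 < r by rewrite lt_min !divr_gt0.
have [k bkp bk] := bb _ _ (nbhs_distance_ball dc p r0).
exists k; split => //.
  move=> q q' /bk /= pq /bk /= pq'; apply: le_trans (distanceD dd p _ _) _.
  rewrite (distanceC dd q) (splitr e) lerD//; apply/ltW.
    by apply: lt_le_trans pq _; rewrite ge_min lexx.
  by apply: lt_le_trans pq' _; rewrite ge_min lexx.
move=> q /(_ _ (nbhs_distance_ball dc q r0)) [q' [/bk /= pq' /= qq']].
apply: e1P => /=; apply: le_lt_trans (distanceD dd q' _ _) _.
rewrite (splitr e1) (distanceC dd q') ltrD//.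
  by apply: lt_le_trans pq' _; rewrite ge_min lexx orbT.
by apply: lt_le_trans qq' _; rewrite ge_min lexx orbT.
Qed.

(* Analytic sets have the Baire property: the pieces [CS s] form a Souslin
   scheme for [C], and off a meager set a point of the open hull of [pi @` C]
   lies in the hulls along a whole branch, which completeness turns into a point
   of [C]. *)
Lemma analytic_baire_prop (O : nat -> set Q) (C : set Q) (pi : Q -> Z) :
  polish_based R Q -> polish_based R Z -> continuous pi ->
  (forall n, open (O n)) -> (forall n, C `<=` O n) ->
  (forall p, (forall n, O n p) -> closure C p -> C p) ->
  baire_prop (pi @` C).
Proof.
move=> [b [d [bb dd dc dK]]] [bz [dz [bbz ddz dcz _]]] cpi oO CO Ccl.
pose small n k := (forall q q', b k q -> b k q' -> d q q' <= n.+1%:R^-1) /\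
  closure (b k) `<=` O n.
pose CS := fix CS (s : seq nat) : set Q := if s is k :: s'
  then [set p | [/\ CS s' p, small (size s') k & b k p]] else C.
pose A s := pi @` CS s.
have CSC s : CS s `<=` C by elim: s => //= k s IH p [/IH].
have CScover s p : CS s p -> exists k, CS (k :: s) p.
  move=> sp.
  have [||k [bkp k1 k2]] := polish_small_cover (p := p) (e := (size
    s).+1%:R^-1) dd dc bb
    (oO (size s)).
  - exact/CO/(CSC s).
  - by rewrite invr_gt0.
  by exists k; split.
have /choice[H HP] : forall s, exists H, [/\ open H, comeager [set z | A s z ->
  H z] &
    forall V, open V -> V `&` H !=set0 -> ~ comeager [set z | V z -> ~ A s z]].
  by move=> s; exact: open_hull bbz.
have cAH : comeager [set z | forall s, A s z -> H s z].
  by apply: comeager_forall => s; have [] := HP s.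
(* If the hulls of the successors missed an open part of [H s], generic points there would lie
   outside [A s], against the choice of [H s]. *)
have cH : comeager [set z | forall s, H s z -> (\bigcup_k H (k :: s)) z].
  apply: comeager_forall => s; have [oH _ Hs] := HP s;
    apply: dense_imply_open => //.
    by apply: bigcup_open => k _; have [] := HP (k :: s).
  move=> W oW WH [w Ww]; apply: contrapT => W0.
  apply: (Hs W oW); first by exists w; split => //; exact: WH.
  apply: comeagerS cAH => z /= AH Wz [p sp pz].
  have [k kp] := CScover _ _ sp.
  by apply: W0; exists z; split => //; exists k => //; apply: AH; exists p.
exists (H [::]); first by have [] := HP [::].
apply: comeagerS (comeagerI cAH cH) => z [AH HH]; split; first exact: (AH [::]).
move=> H0.
pose T := {s | H s z}.
have step (s : T) : {t : T | exists k, sval t = k :: sval s}.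
  case: s => s /= Hs; apply: cid; have [k _ Hk] := HH _ Hs.
  by exists (exist _ (k :: s) Hk), k.
have [f [f0 fS]] := dependent_choice step (exist _ [::] H0 : T).
have fsize n : size (sval (f n)) = n.
  by elim: n => [|n IH]; rewrite ?f0//; have [k ->] := fS n; rewrite /= IH.
have CSmono n m : (n <= m)%N -> CS (sval (f m)) `<=` CS (sval (f n)).
  move=> /subnK <-; elim: (m - n)%N => // k IH p.
  by have [j ->] := fS (k + n)%N => -[/IH].
(* The projection of the [n]-th piece is nonmeager in every ball about [z], hence meets the ball of
   radius [1/(n + 1)]. *)
have /choice[p pP] : forall n, exists p, CS (sval (f n)) p /\ dz z (pi p) <
  n.+1%:R^-1.
  move=> n; have [_ _ Hs] := HP (sval (f n)).
  apply: contrapT => np; apply: (Hs [set y | dz z y < n.+1%:R^-1]).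
  - exact: open_distance_ball.
  - by exists z; split; [rewrite /= distancexx|exact: (svalP (f n))].
  - apply: comeagerS (@comeagerT _) => y _ zy [q sq qy]; apply: np.
    by exists q; rewrite qy.
have pb n m : (n < m)%N -> forall k, sval (f n.+1) = k :: sval (f n) ->
    small n k /\ b k (p m).
  move=> nm k kE; have [+ _] := pP m; move/(CSmono _ _ nm).
  by rewrite kE /= fsize => -[].
have [|l pl] := distance_complete_small (u := p) dK.
  move=> n m m' nm nm'; have [k kE] := fS n.
  have [[sm _] bm] := pb _ _ nm _ kE; have [_ bm'] := pb _ _ nm' _ kE.
  exact: sm.
exists l.
  (* The closure of the piece at level [n + 1] lies in [O n], so the limit is in every [O n]; it is
     also adherent to [C]. *)
  apply: Ccl => [n|N Nl].
    have [k kE] := fS n; have [[_ cl] _] := pb _ _ (ltnSn n) _ kE.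
    apply: cl => N /pl [m _ mN]; exists (p (maxn m n.+1)); split.
      by have [] := pb n (maxn m n.+1) (leq_maxr _ _) _ kE.
    by apply: mN; rewrite /= leq_maxl.
  have [m _ mN] := pl _ Nl; exists (p m); split; last by apply: mN => /=.
  by apply: CSC (pP m).1.
apply: esym; apply: (distance_eq ddz) => e e0.
have /ltr_invS[n ne] : 0 < e / 2 by rewrite divr_gt0.
have e20 : 0 < e / 2 by rewrite divr_gt0.
have [m _ mP] := pl _ (cpi l _ (nbhs_distance_ball dcz (pi l) e20)).
have := mP (maxn m n) (leq_maxl _ _) => /= lm.
apply: le_lt_trans (distanceD ddz (pi (p (maxn m n))) _ _) _.
rewrite (splitr e) (distanceC ddz (pi _)) ltrD//.
apply: lt_trans (pP _).2 (le_lt_trans _ ne).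
by rewrite lef_pV2 ?posrE// ler_nat ltnS leq_maxr.
Qed.

End analytic.

(** * Borel functions and their continuity on comeager sets *)

Section borel_fun.
Context (X Y : topologicalType).

Lemma open_borel_set (A : set X) : open A -> borel_set A.
Proof. exact: sub_sigma_algebra. Qed.

Lemma borel_set_const (P : Prop) : borel_set [set _ : X | P].
Proof.
apply: open_borel_set; have [p|np] := pselect P.
  by rewrite (_ : [set _ | P] = setT); [exact: openT|apply/seteqP; split].
by rewrite (_ : [set _ | P] = set0); [exact: open0|apply/seteqP; split].
Qed.

Lemma borel_setC (A : set X) : borel_set A -> borel_set (~` A).
Proof. by move=> bA; rewrite -setTD; exact: sigma_algebraCD. Qed.

Lemma borel_set_bigcup (J : countType) (D : set J) (A : J -> set X) :
  (forall j, borel_set (A j)) -> borel_set (\bigcup_(j in D) A j).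
Proof.
move=> bA; pose B k := if unpickle k is Some j then
  (if `[< D j >] then A j else set0) else set0.
rewrite (_ : \bigcup_(j in D) A j = \bigcup_k B k).
  apply: sigma_algebra_bigcup => k; rewrite /B.
  case: unpickle => [j|]; last exact: sigma_algebra0.
  by case: asboolP => _; [exact: bA|exact: sigma_algebra0].
apply/seteqP; split=> [x [j Dj Ajx]|x [k _]].
  by exists (pickle j) => //; rewrite /B pickleK; case: asboolP.
by rewrite /B; case: unpickle => // j; case: asboolP => // Dj ?; exists j.
Qed.

Lemma borel_setI (A B : set X) :
  borel_set A -> borel_set B -> borel_set (A `&` B).
Proof.
move=> bA bB; rewrite -[A `&` B]setCK setCI; apply: borel_setC.
rewrite (_ : _ `|` _ = \bigcup_(b in [set: bool]) (if b then ~` A else ~` B)).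
  by apply: borel_set_bigcup => -[]; exact: borel_setC.
apply/seteqP; split=> [x [?|?]|x [[] _ ?]];
  [by exists true|by exists false|by left|by right].
Qed.

Lemma borel_fun_generated (f : X -> Y) :
  (forall A, open A -> borel_set (f @^-1` A)) -> borel_fun f.
Proof.
move=> fo B bB; apply: (bB [set B | borel_set (f @^-1` B)]); split => //.
split=> /=; first by rewrite preimage_set0; exact: sigma_algebra0.
- by move=> A bA; rewrite setTD preimage_setC; exact: borel_setC.
- by move=> A bA; rewrite preimage_bigcup; exact: borel_set_bigcup.
Qed.

Lemma borel_fun_base (f : X -> Y) (J : countType) (b : J -> set Y) :
  (forall y V, nbhs y V -> exists2 j, b j y & b j `<=` V) ->
  (forall j, borel_set (f @^-1` b j)) -> borel_fun f.
Proof.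
move=> bb bf; apply: borel_fun_generated => A oA.
rewrite (_ : A = \bigcup_(j in [set j | b j `<=` A]) b j).
  by rewrite preimage_bigcup; exact: borel_set_bigcup.
apply/seteqP; split=> [y Ay|y [j /= bA /bA//]].
by have [j] := bb _ _ (open_nbhs_nbhs (conj oA Ay)); exists j.
Qed.

Lemma continuous_borel_fun (f : X -> Y) : continuous f -> borel_fun f.
Proof.
move/continuousP => cf; apply: borel_fun_generated => A /cf.
exact: open_borel_set.
Qed.

End borel_fun.

Lemma borel_fun_comp (X Y Z : topologicalType) (f : X -> Y) (g : Y -> Z) :
  borel_fun f -> borel_fun g -> borel_fun (g \o f).
Proof. by move=> bf bg B /bg /bf. Qed.

Lemma borel_reducible_trans (X Y Z : topologicalType) (E : X -> X -> Prop)
    (F : Y -> Y -> Prop) (H : Z -> Z -> Prop) :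
  borel_reducible E F -> borel_reducible F H -> borel_reducible E H.
Proof.
move=> [f bf fP] [g bg gP]; exists (g \o f); first exact: borel_fun_comp.
by move=> x y; rewrite fP gP.
Qed.

Lemma borel_fun_pair (W X Y : topologicalType) (bX : nat -> set X)
    (bY : nat -> set Y) (f : W -> X) (g : W -> Y) : countable_base bX ->
      countable_base bY ->
  borel_fun f -> borel_fun g -> borel_fun (fun w => (f w, g w)).
Proof.
move=> [oX bbX] [oY bbY] bf bg.
apply: (@borel_fun_base _ _ _ (nat * nat)%type (fun ij => bX ij.1 `*` bY ij.2)).
  move=> [x y] V [[P Q] /= [Px Qy] PQV].
  have [i bix biP] := bbX _ _ Px; have [j bjy bjQ] := bbY _ _ Qy.
  exists (i, j) => //= -[x' y'] [/= ? ?].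
  by apply: PQV; split; [exact: biP|exact: bjQ].
move=> [i j] /=.
rewrite (_ : _ @^-1` _ = f @^-1` bX i `&` g @^-1` bY j)//.
by apply: borel_setI; [apply: bf|apply: bg]; exact: open_borel_set.
Qed.

(** By the Baire property the preimage of each [b k] is open modulo a meager set; off the countably
    many exceptions [f] is continuous. *)
Lemma borel_fun_continuous_comeager (X Y : topologicalType) (b : nat -> set Y)
    (f : X -> Y) : countable_base b -> borel_fun f ->
  exists (D O : nat -> set X),
    [/\ forall n, open (D n) /\ dense (D n), forall k, open (O k) &
        forall x, (forall n, D n x) -> forall k, b k (f x) <-> O k x].
Proof.
move=> [ob _] bf.
have /choice[ O OP] : forall k, exists O, open O /\ comeager [set x | b k (f x)
  <-> O x].
  move=> k; have /bf/borel_baire_prop[ O] := open_borel_set (ob k).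
  by exists O.
have [D DP DO] := comeager_forall (fun k => (OP k).2).
exists D, O; split => // [k|x Dx k]; first by have [] := OP k.
by have := DO x (fun n _ => Dx n); exact.
Qed.

(** * Countable products of discrete spaces *)

Lemma baire_dist_lt (R : realType) (x y : baire R) n :
  baire_dist x y < 2 ^- n <-> forall m, (m <= n)%N -> x m = y m.
Proof.
split=> [xy m mn|xy].
  apply/eqP; apply: contraLR xy => /baire_dist_ge xym.
  rewrite -leNgt; apply: le_trans xym.
  by rewrite lef_pV2 ?posrE ?exprn_gt0// ler_eXn2l// ltr1n.
rewrite /baire_dist; case: pselect => [ex|_];
  last by rewrite invr_gt0 exprn_gt0.
case: ex_minnP => k xyk _;
  rewrite ltf_pV2 ?posrE ?exprn_gt0// ltr_eXn2l ?ltr1n//.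
by rewrite ltnNge; apply: contraNN xyk => /xy ->.
Qed.

Lemma exp2V_lt (R : realType) (e : R) : 0 < e -> exists n, 2 ^- n < e.
Proof.
move=> e0; have [n _ /(_ n (leqnn n))] := near_infty_natSinv_expn_lt (PosNum
  e0).
by rewrite div1r; exists n.
Qed.

Section discrete_product.
Context (R : realType) (J : countType) (T : discreteTopologicalType).
Local Notation Y := {ptws J -> T}.
Implicit Types (x y : Y) (s : seq J).

Lemma nbhs_agree x s : nbhs x [set y : Y | forall i, i \in s -> y i = x i].
Proof.
elim: s => [|i s IH]; first by apply: filterS filterT.
have xi : nbhs x [set y : Y | y i = x i].
  by have := @proj_continuous J (fun=> T) i x _ (discrete_set1 (x i)).
apply: filterS (filterI xi IH) => y [/= yi ys] j.
by rewrite inE => /orP[/eqP->|/ys].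
Qed.

(** The finite agreement sets form a filter that converges to [x] in the product topology, so it
    refines the neighbourhoods. *)
Lemma nbhs_agreeP x (V : set Y) : nbhs x V ->
  exists s, [set y : Y | forall i, i \in s -> y i = x i] `<=` V.
Proof.
pose F : set_system Y := filter_from [set: seq J]
  (fun s => [set y : Y | forall i, i \in s -> y i = x i]).
have FF : Filter F.
  apply: filter_from_filter; first by exists [::].
  move=> s t _ _; exists (s ++ t) => // y yst.
  by split=> i i_; apply: yst; rewrite mem_cat i_ ?orbT.
have Fx : F --> x.
  apply/cvg_sup => i U [_ [[W oW <-] Wxi WU]]; exists [:: i] => // y /= yi.
  by apply: WU; rewrite /= yi// mem_seq1.
by move=> /Fx[s _ sV]; exists s.
Qed.

Lemma open_agree x s : open [set y : Y | forall i, i \in s -> y i = x i].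
Proof.
rewrite openE => y /= yx; apply: filterS (nbhs_agree y s) => z zy i i_s.
by rewrite zy// yx.
Qed.

Lemma cvg_agree (u : nat -> Y) (l : Y) :
  (forall i, \forall n \near \oo, u n i = l i) -> u @ \oo --> l.
Proof.
move=> ul V /nbhs_agreeP[s sV]; rewrite nbhs_simpl.
suff : \forall n \near \oo, forall i, i \in s -> u n i = l i.
  by apply: filterS => n un; exact: sV.
elim: s {sV} => [|i s IH]; first by apply: filterS filterT.
apply: filterS (filterI (ul i) IH) => n [/= ui us] j.
by rewrite inE => /orP[/eqP->|/us].
Qed.

Context (code : T -> nat) (code_inj : injective code).

(** Letters are given by their codes, so that the cylinders are indexed by a countable type. *)
Definition cylinder (w : seq (J * nat)) : set Y :=
  [set y | forall p, p \in w -> code (y p.1) = p.2].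

Lemma open_cylinder w : open (cylinder w).
Proof.
rewrite openE => y wy; apply: filterS (nbhs_agree y (map fst w)) => z zy p pw.
by rewrite zy ?wy// map_f.
Qed.

Lemma cylinder_base x (V : set Y) : nbhs x V ->
  exists2 w, cylinder w x & cylinder w `<=` V.
Proof.
move=> /nbhs_agreeP[s sV]; exists [seq (i, code (x i)) | i <- s].
  by move=> _ /mapP[i _ ->].
move=> y wy; apply: sV => i i_s; apply: code_inj.
by apply: (wy (i, code (x i))); apply: map_f.
Qed.

Lemma polish_based_discrete_product : polish_based R Y.
Proof.
pose b k := if unpickle k is Some w then cylinder w else set0.
(* [c] reads [x] along the enumeration of [J] as a point of Baire space, whose distance is pulled
   back; numbers coding nothing get the constant 0. *)
pose c x : baire R := fun n => if unpickle n is Some i then (code (x i)).+1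
  else 0%N.
have cE x y i : c x (pickle i) = c y (pickle i) -> x i = y i.
  by rewrite /c pickleK => -[/code_inj].
exists b, (fun x y => baire_dist (c x) (c y)); split.
- split=> [k|x V /cylinder_base[w wx wV]].
    by rewrite /b; case: unpickle => [w|]; [exact: open_cylinder|exact: open0].
  by exists (pickle w); rewrite /b pickleK.
- split.
  + by move=> *; exact: baire_dist_ge0.
  + move=> x y; split=> [/baire_dist_positivity cxy|->];
    last exact: baire_distxx.
    by apply/funext => i; apply: cE; rewrite cxy.
  + by move=> *; exact: baire_dist_sym.
  + by move=> *; exact: baire_dist_triangle.
- move=> x A; split=> [/nbhs_agreeP[s sA]|[e /exp2V_lt[n ne] eA]].
    exists (2 ^- (\max_(i <- s) pickle i)); first by rewrite invr_gt0 exprn_gt0.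
    move=> y /= /baire_dist_lt xy; apply: sA => i i_s; apply: cE; apply/esym/xy.
    exact: (@leq_bigmax_seq _ s xpredT (fun i => pickle i) i).
  apply: filterS (nbhs_agree x (pmap unpickle (iota 0 n.+1))) => y xy.
  apply: eA => /=; apply: le_lt_trans (ltW _) ne; apply/baire_dist_lt => m mn.
  rewrite /c; case E: (unpickle m) => [i|//]; rewrite xy//.
  by rewrite mem_pmap -E; apply: map_f; rewrite mem_iota.
- move=> u uC.
  have /choice[N NP] : forall i, exists N, forall m n, (N <= m)%N -> (N <= n)%N
    ->
      u m i = u n i.
    move=> i; have [|N uN] := uC (2 ^- (pickle i));
      first by rewrite invr_gt0 exprn_gt0.
    by exists N => m n Nm Nn; apply: cE; have /baire_dist_lt := uN m n Nm Nn;
      exact.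
  exists (fun i => u (N i) i); apply: cvg_agree => i;
    exists (N i) => // n /= Nn.
  by apply: NP.
Qed.

End discrete_product.

(** * Closed subspaces of Polish spaces *)

Section set_type_polish.
Context (R : realType) (X : topologicalType) (A : set X).

Lemma nbhs_set_type (x : A) (V : set A) :
  nbhs x V <-> exists2 W, nbhs (val x) W & val @^-1` W `<=` V.
Proof.
split=> [[_ [[W oW <-] Wx WV]]|[W]].
  by exists W => //; exact: open_nbhs_nbhs.
rewrite nbhsE => -[W' [oW' W'x] W'W] WV.
exists (val @^-1` W'); split => //; first by exists W'.
by move=> y /W'W /WV.
Qed.

Lemma continuous_val : continuous (val : A -> X).
Proof. by move=> x V xV; apply/nbhs_set_type; exists V. Qed.

Lemma polish_based_set_type : closed A -> polish_based R X -> polish_based R A.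
Proof.
move=> cA [b [d [[ob bb] dd dc dK]]].
exists (fun k => val @^-1` b k), (fun x y => d (val x) (val y)); split.
- split=> [k|x V /nbhs_set_type[W /bb[k kx kW] WV]].
    by have /continuousP := continuous_val; apply.
  by exists k => // y /kW /WV.
- have [d0 d1 ds dt] := dd; split => //.
  by move=> x y; rewrite d1; split=> [/val_inj|->].
- move=> x V; split=> [/nbhs_set_type[W /dc[e e0 eW] WV]|[e e0 eV]].
    by exists e => // y /eW /WV.
  apply/nbhs_set_type; exists [set y | d (val x) y < e]; last exact: eV.
  by apply/dc; exists e.
- move=> u /dK[l ul].
  have Al : A l.
    apply: cA => V /ul[n _ nV]; exists (val (u n)); split;
      last by apply: nV => /=.
    by have := valP (u n); rewrite inE.
  exists (exist _ l (mem_set Al)) => V /nbhs_set_type[W /= lW WV].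
  have [n _ nW] := ul _ lW; exists n => // m /nW; exact: WV.
Qed.

End set_type_polish.

(** * The equivalence relation E1 *)

Lemma distance_complete_geometric (R : realType) (X : topologicalType)
    (d : X -> X -> R) (u : nat -> X) : is_distance d -> distance_complete d ->
  (forall n, d (u n) (u n.+1) <= 2 ^- n) -> exists l : X, u @ \oo --> l.
Proof.
move=> dd dK uS; apply: dK => e e0.
have un n k : d (u n) (u (k + n)%N) <= 2 * 2 ^- n - 2 * 2 ^- (k + n).
  elim: k => [|k IH]; first by rewrite (distancexx dd) subrr.
  apply: le_trans (distanceD dd (u (k + n)%N) _ _) _; rewrite addSn.
  apply: le_trans (lerD IH (uS _)) _.
  rewrite exprS invfM mulrA divff// mul1r; lra.
have un' n m : (n <= m)%N -> d (u n) (u m) <= 2 * 2 ^- n.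
  move=> /subnK <-; apply: le_trans (un n _) _.
  by rewrite lerBlDr lerDl mulr_ge0.
have /exp2V_lt[N Ne] : 0 < e / 4 by rewrite divr_gt0.
exists N => m n Nm Nn; apply: le_lt_trans (distanceD dd (u N) _ _) _.
rewrite (distanceC dd); have := un' _ _ Nm; have := un' _ _ Nn; lra.
Qed.

(* The coordinates of a point of [{ptws nat -> bool}] are split into infinitely
   many infinite rows, so that the space is a copy of (2^N)^N. *)
Definition row (i : nat) : nat := logn 2 i.+1.

Lemma row_unbounded n l : exists2 i, (l <= i)%N & row i = n.
Proof.
(* [i + 1 = 2^n (2l + 1)] exceeds [l] and has 2-adic valuation [n], the second factor being odd. *)
exists (2 ^ n * l.*2.+1).-1.
  rewrite -ltnS prednK ?muln_gt0 ?expn_gt0//.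
  by rewrite -[l.+1]mul1n leq_mul ?expn_gt0// ltnS -addnn leq_addr.
rewrite /row prednK ?muln_gt0 ?expn_gt0// lognM ?expn_gt0// pfactorK//.
rewrite (_ : logn 2 _ = 0)%N ?addn0//.
by rewrite logn_coprime// coprime2n /= odd_double.
Qed.

Definition E1 (x y : {ptws nat -> bool}) : Prop :=
  exists n, forall i, (n <= row i)%N -> x i = y i.

Lemma polish_based_cantor (R : realType) : polish_based R {ptws nat -> bool}.
Proof. by apply: (@polish_based_discrete_product R nat bool nat_of_bool) => -[]
  []. Qed.

(** * Changing one row of a point *)

Section mix.
Local Notation Y := {ptws nat -> bool}.

Definition mix n (x y : Y) : Y := fun i => if row i == n then y i else x i.

Lemma mix_mixr n x y : mix n x (mix n y x) = x.
Proof. by apply/funext => i; rewrite /mix; case: eqP. Qed.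

Lemma mix_mixl n x y z : mix n (mix n x y) z = mix n x z.
Proof. by apply/funext => i; rewrite /mix; case: eqP. Qed.

Lemma mixr_mix n x y : mix n y (mix n x y) = y.
Proof. by apply/funext => i; rewrite /mix; case: eqP. Qed.

Lemma E1_mix n x y : E1 x (mix n x y).
Proof.
by exists n.+1 => i; rewrite /mix; case: eqP => // ->; rewrite ltnn.
Qed.

Lemma mix_continuous n : continuous (fun p : Y * Y => mix n p.1 p.2).
Proof.
move=> [x y] V /nbhs_agreeP[s sV]; rewrite nbhs_simpl /=.
exists ([set z : Y | forall i, i \in s -> z i = x i],
        [set z : Y | forall i, i \in s -> z i = y i]).
  by split; exact: nbhs_agree.
move=> [x' y'] [/= xx' yy']; apply: sV => i i_s.
by rewrite /mix /=; case: ifP => _; [exact: yy'|exact: xx'].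
Qed.

Lemma mix_open_map n : open_map (fun p : Y * Y => mix n p.1 p.2).
Proof.
apply: open_mapP => -[x y] V [[P Q] /= [/nbhs_agreeP[s sP] /nbhs_agreeP[t tQ]]
  PQV].
apply: filterS (nbhs_agree _ (s ++ t)) => z zst.
(* The rows that [mix] reads are taken from [z], the others stay those of [x] and [y]. *)
exists (mix n z x, mix n y z); last first.
  by apply/funext => i; rewrite /mix /=; case: eqP.
apply: PQV; split; [apply: sP|apply: tQ] => i i_; rewrite /mix /=;
  by case rin: (row i == n) => //; rewrite zst ?mem_cat ?i_ ?orbT// /mix rin.
Qed.

Lemma mixr_continuous n x : continuous (mix n x).
Proof.
move=> y V /nbhs_agreeP[s sV]; rewrite nbhs_simpl /=.
apply: filterS (nbhs_agree y s) => z zy; apply: sV => i i_s.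
by rewrite /mix /=; case: ifP => // _; exact: zy.
Qed.

Lemma comeager_row_neq n (x : Y) :
  comeager [set y : Y | exists2 i, row i = n & y i <> x i].
Proof.
apply: open_dense_comeager.
  rewrite openE => y [i rin yx]; apply: filterS (nbhs_agree y [:: i]) => z zy.
  by exists i => //; rewrite zy// mem_seq1.
move=> V [y Vy] oV.
have [s sV] := nbhs_agreeP (open_nbhs_nbhs (conj oV Vy)).
(* A coordinate of row [n] beyond the finitely many constrained ones can be set freely. *)
have [i si rin] := row_unbounded n (\max_(j <- s) j).+1.
exists (fun j => if j == i then ~~ x j else y j); split.
  apply: sV => j js; case: eqP => // ji; move: si; rewrite -ji ltnNge.
  by rewrite (@leq_bigmax_seq _ s xpredT id j).
by exists i => //; rewrite eqxx; case: (x i).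
Qed.

(** By Kuratowski-Ulam along the open map [mix n], generic one-row changes of a generic point stay
    in a comeager set. Imposing this infinitely often and intersecting gives a set stable under
    generic changes. *)
Lemma hereditary_comeager (R : realType) (A : set Y) : comeager A ->
  exists H : set Y, [/\ comeager H, H `<=` A &
    forall x n, H x -> comeager [set y | H (mix n x y)]].
Proof.
move=> cA.
have [b [_ [bb _ _ _]]] := polish_based_cantor R.
pose H := fix H m : set Y := if m is m'.+1 then
  H m' `&` [set x | forall n, comeager [set y | H m' (mix n x y)]] else A.
have cH m : comeager (H m).
  elim: m => //= m IH; apply: comeagerI => //; apply: comeager_forall => n.
  apply: (kuratowski_ulam (A := [set p | H m (mix n p.1 p.2)]) bb).
  apply: (comeager_preimage (f := fun p : Y * Y => mix n p.1 p.2)) IH.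
    exact: mix_continuous.
  exact: mix_open_map.
exists [set x | forall m, H m x]; split.
- exact: comeager_forall.
- by move=> x /(_ 0).
- by move=> x n Hx; apply: comeager_forall => m; have [_] := Hx m.+1; exact.
Qed.

End mix.

Lemma open_map_pair (X Y Z : topologicalType) (f : X -> Y) :
  open_map f -> open_map (fun p : X * Z => (f p.1, p.2)).
Proof.
move=> of_; apply: open_mapP => -[x z] V [[P Q] /= [Px Qz] PQV].
exists (f @` interior P, Q) => /=.
  split => //; apply: open_nbhs_nbhs; split; first exact/of_/open_interior.
  by exists x.
move=> [_ z'] [/= [x' Px' <-] Qz']; exists (x', z') => //.
by apply: PQV; split => //=; exact: interior_subset.
Qed.

Lemma continuous_pair_map (X Y Z : topologicalType) (f : X -> Y) :
  continuous f -> continuous (fun p : X * Z => (f p.1, p.2)).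
Proof.
move=> cf; apply: continuous_pair; last exact: snd_continuous.
exact: continuous_compT (@fst_continuous _ _) cf.
Qed.

(** * E1 does not reduce to orbit equivalence relations *)

Section translation.
Context (G : topologicalGroupType).

Lemma mulg_continuous2 (X : topologicalType) (u v : X -> G) :
  continuous u -> continuous v -> continuous (fun x => (u x * v x)%g).
Proof.
move=> cu cv; exact: continuous_compT (continuous_pair cu cv) (@mulg_continuous
  G).
Qed.

Lemma invg_continuous1 (X : topologicalType) (u : X -> G) :
  continuous u -> continuous (fun x => (u x)^-1%g).
Proof. by move=> cu; exact: continuous_compT cu (@invg_continuous G). Qed.

Lemma mulgr_continuous (k : G) : continuous (fun h : G => (h * k)%g).
Proof. by apply: mulg_continuous2 => x; [exact: cvg_id|exact: cvg_cst]. Qed.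

Lemma mulgr_open_map (k : G) : open_map (fun h : G => (h * k)%g).
Proof.
move=> V oV; rewrite (_ : _ @` V = (fun h => (h * k^-1)%g) @^-1` V).
  by have /continuousP := @mulgr_continuous (k^-1)%g; exact.
apply/seteqP; split=> [_ [h Vh <-]|h /= Vh]; first by rewrite /= mulgK.
by exists (h * k^-1)%g => //; rewrite mulgVK.
Qed.

Lemma nbhs1_divg (U : set G) : nbhs 1%g U ->
  exists W, [/\ open W, W 1%g & forall g h, W g -> W h -> U (g * h^-1)%g].
Proof.
move=> U1.
have : continuous (fun p : G * G => (p.1 * p.2^-1)%g).
  apply: mulg_continuous2; first exact: fst_continuous.
  by apply: invg_continuous1; exact: snd_continuous.
move=> /(_ (1%g, 1%g) U);
  rewrite /= invg1 mulg1 => /(_ U1)[[P Q] /= [P1 Q1] PQ].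
exists (interior P `&` interior Q); split.
- by apply: openI; exact: open_interior.
- by [].
- move=> g h [/interior_subset Pg _] [_ /interior_subset Qh].
  exact: (PQ (g, h)).
Qed.

End translation.

(** * Generic row changes under a reduction of [E1] to an orbit relation *)

Section orbit_reduction.
Context (R : realType) (G : topologicalGroupType) (X : topologicalType)
  (act : G -> X -> X).
Local Notation Y := {ptws nat -> bool}.
Context (f : Y -> X).
Context (pG : polish_based R G) (pX : polish_based R X).
Context (actP : is_group_action act).
Context (fE : forall x y, E1 x y <-> orbit_equiv act (f x) (f y)).

(* [F] is continuous on the comeager set [\bigcap_n D n]; the open set [O k]
   is the trace of the preimage of the basic open set [bX k]. *)
Let F (p : Y * G) : X := act p.2 (f p.1).
Context (bX : nat -> set X) (D O : nat -> set (Y * G)).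
Context (bXP : countable_base bX) (DP : forall n, open (D n) /\ dense (D n))
  (oO : forall k, open (O k))
  (DO : forall p, (forall n, D n p) -> forall k, bX k (F p) <-> O k p).

Let pY : polish_based R Y := polish_based_cantor R.

Let act1 x : act 1%g x = x. Proof. by have [] := actP. Qed.
Let actM g h x : act (g * h)%g x = act g (act h x).
Proof. by have [] := actP. Qed.

Definition generic_fiber (y : Y) : Prop :=
  comeager [set h | forall n, D n (y, h)].

Lemma comeager_generic_fiber : comeager generic_fiber.
Proof.
have [b [_ [bb _ _ _]]] := pG.
apply: (kuratowski_ulam (A := [set p | forall n, D n p]) bb).
by apply: comeager_forall => n; have [] := DP n; exact: open_dense_comeager.
Qed.

Lemma generic_fiber_translate y k : generic_fiber y ->
  comeager [set h | forall n, D n (y, (h * k)%g)].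
Proof.
move=> yF.
apply: (comeager_preimage (f := fun h : G => (h * k)%g)) yF.
  exact: mulgr_continuous.
exact: mulgr_open_map.
Qed.

(** On the set where [F] is continuous, inequality of two values is an open condition, since [X] is
    Hausdorff. *)
Lemma F_sep (p q : Y * G) :
  (forall n, D n p) -> (forall n, D n q) -> F p <> F q ->
  exists k l, [/\ O k p, O l q &
    forall p' q', (forall n, D n p') -> (forall n, D n q') ->
    O k p' -> O l q' -> F p' <> F q'].
Proof.
move=> Dp Dq; have [_ [d [_ dd dc _]]] := pX.
move=> /(distance_hausdorff dd dc)[V [W [oV oW Vp Wq VW]]].
have [_ bb] := bXP.
have [k kp kV] := bb _ _ (open_nbhs_nbhs (conj oV Vp)).
have [l lq lW] := bb _ _ (open_nbhs_nbhs (conj oW Wq)).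
exists k, l; split; [exact/DO|exact/DO|].
move=> p' q' Dp' Dq' /DO-/(_ Dp')/kV Vp' /DO-/(_ Dq')/lW Wq' pq.
have : (V `&` W) (F p') by split => //; rewrite pq.
by rewrite VW.
Qed.

Definition related n (U : set G) : set (Y * Y) :=
  [set p | exists2 g, U g & act g (f p.1) = f (mix n p.1 p.2)].

(** For generic pairs, being related means [F (y, h) = F (mix n y z, h')] for some [h], [h'] with
    [h'^-1 h] in [U]. Where [F] is continuous this condition is relatively closed, so its projection
    is analytic. *)
Lemma related_baire_prop n U : open U -> baire_prop (related n U).
Proof.
move=> oU.
pose e1 (q : (Y * Y) * (G * G)) : Y * G := (q.1.1, q.2.1).
pose e2 (q : (Y * Y) * (G * G)) : Y * G := (mix n q.1.1 q.1.2, q.2.2).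
pose e3 (q : (Y * Y) * (G * G)) : G := (q.2.2^-1 * q.2.1)%g.
have c1 : continuous (fun q : (Y * Y) * (G * G) => q.1).
  exact: fst_continuous.
have c2 : continuous (fun q : (Y * Y) * (G * G) => q.2).
  exact: snd_continuous.
have c21 := continuous_compT c2 (@fst_continuous _ _).
have c22 := continuous_compT c2 (@snd_continuous _ _).
have ce1 : continuous e1.
  exact: continuous_pair (continuous_compT c1 (@fst_continuous _ _)) c21.
have ce2 : continuous e2.
  exact: continuous_pair (continuous_compT c1 (@mix_continuous n)) c22.
have ce3 : continuous e3 by apply: mulg_continuous2 => //;
  exact: invg_continuous1.
pose P j := e1 @^-1` D j `&` (e2 @^-1` D j `&` e3 @^-1` U).
pose C := (\bigcap_j P j) `&` [set q | F (e1 q) = F (e2 q)].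
have CD q : C q -> (forall j, D j (e1 q)) /\ (forall j, D j (e2 q)).
  by move=> [Pq _]; split=> j; have [? []] := Pq j I.
apply: (@baire_prop_ext _ _ (fst @` C)); last first.
  apply: (analytic_baire_prop (R := R) (O := P)).
  - by apply: polish_based_prod; exact: polish_based_prod.
  - exact: polish_based_prod.
  - by move=> q; exact: cvg_fst.
  - move=> j; apply: openI.
      by move/continuousP: ce1; apply; have [] := DP j.
    apply: openI; last by move/continuousP: ce3; exact.
    by move/continuousP: ce2; apply; have [] := DP j.
  - by move=> j q [+ _]; exact.
  - move=> q Pq Cq; split => //=.
    have D1 j : D j (e1 q) by have [] := Pq j.
    have D2 j : D j (e2 q) by have [_ []] := Pq j.
    apply: contrapT => /(F_sep D1 D2)[k [l [Ok Ol kl]]].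
    have [|q' [Cq' [Ok' Ol']]] := Cq (e1 @^-1` O k `&` e2 @^-1` O l).
      apply: filterI.
        by apply: ce1; exact: open_nbhs_nbhs.
      by apply: ce2; exact: open_nbhs_nbhs.
    have [D1' D2'] := CD _ Cq'.
    by have [_] := Cq'; exact: kl.
have cg1 : comeager [set p : Y * Y | generic_fiber p.1].
  apply: (comeager_preimage (f := fst)) comeager_generic_fiber.
    by move=> q; exact: cvg_fst.
  exact: fst_open.
have cg2 : comeager [set p : Y * Y | generic_fiber (mix n p.1 p.2)].
  apply: (comeager_preimage (f := fun p : Y * Y => mix n p.1 p.2))
    comeager_generic_fiber.
    exact: mix_continuous.
  exact: mix_open_map.
apply: comeagerS (comeagerI cg1 cg2) => -[y z] [/= gy gm]; split.
  move=> [g Ug /= gf].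
  (* For generic [h] both [(y, h)] and [(mix n y z, h g^-1)] lie in every [D j], and [F] takes the
     same value at them. *)
  have [|h _ [Dh Dhg]] := comeager_nonempty pG openT (ex_intro _ 1%g I) (A :=
      [set h | forall n, D n (y, h)] `&` [set h | forall k, D k (mix n y z, (h
        * g^-1)%g)]).
    apply: comeagerS (comeagerI gy (generic_fiber_translate g^-1%g gm)).
    by move=> h ? _.
  exists ((y, z), (h, (h * g^-1)%g)) => //; split=> [j _|/=].
    split; first exact: Dh.
    split; first exact: Dhg.
    by rewrite /= /e3 /= invgM invgK mulgVK.
  by rewrite /F /e1 /e2 /= -gf -actM mulgVK.
move=> [[[y' z'] [h h']] [Pq /= Fq] [<- <-]].
have [_ [_ Uh]] := Pq 0 I.
exists (h'^-1 * h)%g => //=; rewrite actM.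
by move: Fq; rewrite /F /e1 /e2 /= => ->; rewrite -actM mulVg act1.
Qed.

Lemma relatedT n (p : Y * Y) : exists g, act g (f p.1) = f (mix n p.1 p.2).
Proof. by have [+ _] := fE p.1 (mix n p.1 p.2); apply; exact: E1_mix. Qed.

Section locus.
Context (n : nat) (U : set G) (Om : set (Y * Y)).
Context (oOm : open Om)
  (OmP : forall V, open V -> comeager [set p | V p -> related n U p] ->
    V `<=` Om).

(* [(y, mix n a y)] is [(y, a)] with row [n] of [a] replaced by that of [y]. *)
Definition near_related : set Y := [set y | exists a, Om (y, mix n a y)].

Lemma near_related_open : open near_related.
Proof.
rewrite (_ : near_related =
    \bigcup_(a in [set: Y]) ((fun y => (y, mix n a y)) @^-1` Om)).
  apply: bigcup_open => a _.
  have /continuousP : continuous (fun y : Y => (y, mix n a y)).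
    by apply: continuous_pair => [y|]; [exact: cvg_id|exact: mixr_continuous].
  exact.
by apply/seteqP; split=> [y [a ay]|y [a _ ay]]; exists a.
Qed.

(** One point is taken in each nonempty basic set; the [x] with [g x^-1] in [W] form a neighbourhood
    of [g], which contains one of these points. *)
Lemma countable_translates (W : set G) : open W -> W 1%g ->
  exists c : nat -> G, forall g, exists k, W (g * (c k)^-1)%g.
Proof.
move=> oW W1; have [b [_ [[ob bb] _ _ _]]] := pG.
have /choice[c cP] : forall k, exists g, b k !=set0 -> b k g.
  move=> k; have [[g bg]|nb] := pselect (b k !=set0); first by exists g.
  by exists 1%g => /nb.
exists c => g.
have cg : continuous (fun x => (g * x^-1)%g).
  by apply: mulg_continuous2; [move=> x; exact: cvg_cst|exact: invg_continuous].
have [|k kg kW] := bb g ((fun x => (g * x^-1)%g) @^-1` W).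
  by apply: cg; rewrite mulgV; exact: open_nbhs_nbhs.
by exists k; apply: kW; apply: cP; exists g.
Qed.

Lemma related_box (W : set G) (c : G) (V1 V2 : set Y) : open U ->
  (forall g h, W g -> W h -> U (g * h^-1)%g) -> open V1 -> open V2 ->
  comeager [set p | (V1 `*` V2) p -> related n [set g | W (g * c^-1)%g] p] ->
  forall y a, V1 y -> V2 a -> Om (mix n y a, a).
Proof.
move=> oU WU oV1 oV2 cV y a V1y V2a.
have [OU oOU cOU] := related_baire_prop n oU.
pose Psi (q : (Y * Y) * Y) : Y * Y := (mix n q.1.1 q.1.2, q.2).
have cPsi : continuous Psi by exact: continuous_pair_map (@mix_continuous n).
have oPsi : open_map Psi by exact: open_map_pair (@mix_open_map n).
pose V3 := (V1 `*` V2) `*` V2.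
have oV3 : open V3 by apply: openX => //; exact: openX.
suff cPV : comeager [set p | (Psi @` V3) p -> related n U p].
  apply: (OmP (oPsi _ oV3) cPV).
  by exists ((y, a), a).
suff cPO : comeager [set p | (Psi @` V3) p -> OU p].
  by apply: comeagerS (comeagerI cOU cPO) => p [/= rO VO] /VO /rO.
apply: dense_imply_open => //; first exact: oPsi.
(* If [OU] missed [W'], a generic triple of [V3] sent into [W'] would still be related through
   [h g^-1], hence lie in [OU]. *)
move=> W' oW' W'V [w W'w]; apply: contrapT => W'O.
have [q0 V3q0 q0w] := W'V _ W'w.
have pY3 : polish_based R ((Y * Y) * Y)%type.
  by apply: polish_based_prod pY; exact: polish_based_prod.
have c1 : comeager [set q : (Y * Y) * Y | (V1 `*` V2) q.1 ->
    related n [set g | W (g * c^-1)%g] q.1].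
  by apply: (comeager_preimage (f := fst)) cV;
    [exact: fst_continuous|exact: fst_open].
have c2 : comeager [set q : (Y * Y) * Y | (V1 `*` V2) (q.1.1, q.2) ->
    related n [set g | W (g * c^-1)%g] (q.1.1, q.2)].
  apply: (comeager_preimage (f := fun q : (Y * Y) * Y => (q.1.1, q.2))) cV.
    exact: continuous_pair_map (@fst_continuous Y Y).
  by apply: open_map_pair; exact: fst_open.
have c3 : comeager [set q | related n U (Psi q) <-> OU (Psi q)].
  exact: (comeager_preimage (f := Psi)) cOU.
have [|||q [W'q V3q] Hq] := @comeager_nonempty R _
    [set q | OU (Psi q)] (Psi @^-1` W' `&` V3) pY3.
- by apply: openI => //; move/continuousP: cPsi; exact.
- by exists q0; split => //=; rewrite q0w.
- apply: comeagerS (comeagerI c1 (comeagerI c2 c3)).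
  move=> [[y' a'] b'] [/= r1 [r2 r3]] [_ [[/= V1y' V2a'] V2b']].
  apply/r3; have [g Wg /= gE] := r1 (conj V1y' V2a').
  have [h Wh /= hE] := r2 (conj V1y' V2b').
  exists (h * g^-1)%g; last first.
    by rewrite /= mix_mixl -hE -gE -actM mulgVK.
  by have := WU _ _ Wh Wg; rewrite /= invgM invgK mulgA mulgVK.
- by apply: W'O; exists (Psi q).
Qed.

(** Every pair is related through some element of [G], so for one of countably many translates of
    [W] the relation is nonmeager on [V * V]. By the Baire property it is then comeager in a box, to
    which [related_box] applies. *)
Lemma near_related_dense : open U -> U 1%g -> dense near_related.
Proof.
move=> oU U1 V0 [y0 V0y0] oV0.
have [W [oW W1 WU]] := nbhs1_divg (open_nbhs_nbhs (conj oU U1)).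
have [c cP] := countable_translates oW W1.
have [s sV0] := nbhs_agreeP (open_nbhs_nbhs (conj oV0 V0y0)).
pose V := [set y : Y | forall i, i \in s -> y i = y0 i].
have oV : open V by exact: open_agree.
have oVV : open (V `*` V) by exact: openX.
have oWc k : open [set g | W (g * (c k)^-1)%g].
  by have /continuousP := @mulgr_continuous G (c k)^-1%g; exact.
have /existsNP[k nck] : ~ forall k,
    comeager [set p | (V `*` V) p -> ~ related n [set g | W (g * (c k)^-1)%g]
      p].
  move=> /comeager_forall ck.
  have [||[y a] _ ya] := @comeager_nonempty R _ [set p | forall k,
      ~ related n [set g | W (g * (c k)^-1)%g] p] (V `*` V) (polish_based_prod
        pY pY) oVV.
  - by exists (y0, y0).
  - by apply: comeagerS ck => p pk Vp k; exact: pk.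
  have [g gE] := relatedT n (y, a); have [k Wk] := cP g.
  by apply: (ya k); exists g.
have [Ok oOk cOk] := related_baire_prop n (oWc k).
have [[[y1 a1] [[Vy1 Va1] Oya]]|nO] := pselect ((V `*` V) `&` Ok !=set0);
  last first.
  exfalso; apply: nck; apply: comeagerS cOk => p /= pO Vp /pO Op.
  by apply: nO; exists p.
have [[P Q] /= [Py Qa] PQ] : nbhs (y1, a1) ((V `*` V) `&` Ok).
  by apply: open_nbhs_nbhs; split => //; exact: openI.
have PV : P `<=` V.
  by move=> y Py'; have [[]] := PQ (y, a1) (conj Py' (nbhs_singleton Qa)).
have QV : Q `<=` V.
  by move=> a Qa'; have [[]] := PQ (y1, a) (conj (nbhs_singleton Py) Qa').
have ya := related_box oU WU (open_interior P) (open_interior Q).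
exists (mix n y1 a1); split.
  apply: sV0 => i i_s; rewrite /mix; case: ifP => _; first exact: Va1.
  exact: Vy1.
exists a1; rewrite mixr_mix.
apply: (ya (c k)) => //; apply: comeagerS cOk => -[y a] /= pO.
move=> [/interior_subset Py' /interior_subset Qa']; apply/pO.
by have [] := PQ (y, a) (conj Py' Qa').
Qed.

End locus.

(** One step of the final construction: from a point of [H], row [n] can be truly changed within [H]
    by an arbitrarily small amount in [Y] and in [G]. Staying in each open [L j] keeps the limit in
    [generic_fiber]. *)
Lemma generic_steps : exists (H : set Y) (L : nat -> set Y),
  [/\ comeager H, forall j, open (L j), \bigcap_j L j `<=` generic_fiber,
      forall j, H `<=` L j &
      forall y n (k : G) (V : set Y) (K : set G), H y -> nbhs y V -> nbhs k K ->
        exists z g, [/\ H z, V z, K (k * g^-1)%g, act g (f y) = f z &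
          (forall i, row i <> n -> z i = y i) /\
          exists2 i, row i = n & z i <> y i]].
Proof.
have [bG [_ [[obG bbG] _ _ _]]] := pG.
have [bY [_ [bbY _ _ _]]] := pY.
have [b2 [_ [bb2 _ _ _]]] := polish_based_prod pY pY.
have [L LP LF] := comeager_generic_fiber.
have /choice[Om OmP] : forall nk : nat * nat, exists M,
    [/\ open M, comeager [set p | M p -> related nk.1 (bG nk.2) p] &
        forall V, open V -> comeager [set p | V p -> related nk.1 (bG nk.2) p]
          ->
        V `<=` M].
  by move=> nk; exact: comeager_locus bb2.
pose H0 := [set y | forall j, L j y] `&` [set y | forall nk : nat * nat,
  (bG nk.2 1%g -> near_related nk.1 (Om nk) y) /\
  comeager [set z | Om nk (y, z) -> related nk.1 (bG nk.2) (y, z)]].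
have cH0 : comeager H0.
  apply: comeagerI.
    by apply: comeager_forall => j; have [] := LP j; exact: open_dense_comeager.
  apply: comeager_forall => nk; have [oM cM MP] := OmP nk; apply: comeagerI.
    have [b1|nb1] := pselect (bG nk.2 1%g); last first.
      by apply: comeagerS (@comeagerT _) => y _ /nb1.
    have oN := near_related_open nk.1 oM.
    have dN := near_related_dense MP (obG _) b1.
    by apply: comeagerS (open_dense_comeager oN dN) => y ? _.
  exact: (kuratowski_ulam (A := [set p | Om nk p -> related nk.1 (bG nk.2) p])
    bbY).
have [H [cH HH0 Hmix]] := hereditary_comeager R cH0.
exists H, L; split => //.
- by move=> j; have [] := LP j.
- by move=> j y /HH0[+ _]; exact.
move=> y n k V K Hy yV kK.
have ck : continuous (fun g : G => (k * g^-1)%g).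
  by apply: mulg_continuous2; [move=> x; exact: cvg_cst|exact: invg_continuous].
have [|j j1 jK] := bbG 1%g ((fun g : G => (k * g^-1)%g) @^-1` K).
  by apply: ck; rewrite invg1 mulg1.
have [_ /(_ (n, j))[/= /(_ j1)[a Oma] cOm]] := HH0 _ Hy.
have [oM _ _] := OmP (n, j).
pose B := [set z | Om (n, j) (y, z)] `&` mix n y @^-1` interior V.
have oB : open B.
  apply: openI.
    have /continuousP : continuous (fun z : Y => (y, z)).
      by apply: continuous_pair => z; [exact: cvg_cst|exact: cvg_id].
    exact.
  by have /continuousP := @mixr_continuous n y; apply; exact: open_interior.
have [||z [_ /interior_subset Vz] [[rz Hz] dz]] := @comeager_nonempty R _
    ([set z | related n (bG j) (y, z)] `&` [set z | H (mix n y z)] `&`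
     [set z : Y | exists2 i, row i = n & z i <> y i]) B pY oB.
(* For [z = mix n a y] the changed point [mix n y z] is [y] itself, which lies in the interior of
   [V]. *)
- by exists (mix n a y); split => //=; rewrite mix_mixr.
- apply: comeagerS (comeagerI (comeagerI cOm (Hmix y n Hy)) (comeager_row_neq n
  y)).
  by move=> z [[/= Or Hz] dz] [/= Omz _]; split => //; split => //; exact: Or.
have [g jg /= gE] := rz.
exists (mix n y z), g; split => //; first exact: jK.
split=> [i /eqP/negPf rin|]; first by rewrite /mix rin.
by have [i rin zy] := dz; exists i => //; rewrite /mix rin eqxx.
Qed.

Lemma E1_orbit_absurd : False.
Proof.
have [H [L [cH oL LF HL stepH]]] := generic_steps.
have [_ [d [_ dd dc dK]]] := pG.
have [y0 _ Hy0] : exists2 y0, [set: Y] y0 & H y0.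
  apply: (comeager_nonempty pY openT); first by exists (fun=> true).
  by apply: comeagerS cH => y ? _.
(* A state holds the step number, the current point [y], an element [k] with [k f(y) = f(y0)], and a
   finite list of coordinates that later steps keep. *)
pose T := {t : nat * Y * G * seq nat | H t.1.1.2 /\ act t.1.2 (f t.1.1.2) = f
  y0}.
pose nn (t : T) := (sval t).1.1.1.
pose yy (t : T) := (sval t).1.1.2.
pose kk (t : T) := (sval t).1.2.
pose ss (t : T) := (sval t).2.
(* Agreement on the new list forces a point into [L] at this step, so the limit will lie in every
   [L n]. *)
pose r (t t' : T) := [/\ nn t' = (nn t).+1, d (kk t) (kk t') <= 2 ^- (nn t),
  (forall i, i \in ss t -> yy t' i = yy t i /\ i \in ss t'),
  [set y : Y | forall i, i \in ss t' -> y i = yy t' i] `<=` L (nn t) &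
  (forall i, row i <> nn t -> yy t' i = yy t i) /\
          exists2 i, row i = nn t & yy t' i <> yy t i].
have step (t : T) : {t' | r t t'}.
  case: t => [[[[n y] k] s] /= [Hy kE]]; rewrite /r /nn /yy /kk /ss /=;
    apply: cid.
  have e0 : 0 < 2 ^- n :> R by rewrite invr_gt0 exprn_gt0.
  have [z [g [Hz sz kg gE [zy1 zy2]]]] := stepH y n k _ _ Hy (nbhs_agree y s)
    (nbhs_distance_ball dc k e0).
  have [s' s'L] := nbhs_agreeP (open_nbhs_nbhs (conj (oL n) (HL n _ Hz))).
  have zP : H z /\ act (k * g^-1)%g (f z) = f y0.
    by split => //; rewrite -gE -actM mulgVK.
  exists (exist _ (n.+1, z, (k * g^-1)%g, s ++ s') zP); split => //=.
  - exact: ltW.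
  - by move=> i i_s; rewrite mem_cat i_s; split => //; exact: sz.
  - by move=> w wz; apply: s'L => i i_s; apply: wz; rewrite mem_cat i_s orbT.
have y0P : H y0 /\ act 1%g (f y0) = f y0 by split.
have [u [u0 uS]] := dependent_choice step (exist _ (0%N, y0, 1%g, [::]) y0P :
  T).
have un n : nn (u n) = n.
  by elim: n => [|n IH]; rewrite ?u0//; have [-> _ _ _ _] := uS n; rewrite IH.
have urow n m i : (n <= m)%N -> (forall j, (n <= j < m)%N -> row i <> j) ->
    yy (u m) i = yy (u n) i.
  move=> /subnK <-; elim: (m - n)%N => // j IH ij.
  have [_ _ _ _ [+ _]] := uS (j + n)%N; rewrite un => ->.
    by apply: IH => l /andP[nl lj]; apply: ij; rewrite nl ltnS ltnW.
  by apply: ij; rewrite leq_addl /=.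
(* Row [m] changes only at step [m], so coordinate [i] is final from step [row i + 1] on. *)
pose yoo : Y := fun i => yy (u (row i).+1) i.
have yooE n i : (row i < n)%N -> yy (u n) i = yoo i.
  by move=> rin; apply: urow => // j /andP[ij _] rij; rewrite rij ltnn in ij.
have yooL n : L n yoo.
  have [_ _ _ + _] := uS n; rewrite un; apply => i i_s.
  have us m : (n < m)%N -> yy (u m) i = yy (u n.+1) i /\ i \in ss (u m).
    move=> /subnK <-; elim: (m - n.+1)%N => // j [IH1 IH2].
    by have [_ _ /(_ _ IH2)[-> ?] _ _] := uS (j + n.+1)%N.
  rewrite -(@yooE (maxn (row i).+1 n.+1)) ?leq_maxl//.
  by have [] := us _ (leq_maxr (row i).+1 n.+1).
have [|k kl] := @distance_complete_geometric R _ d (kk \o u) dd dK.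
  by move=> n /=; have [_ + _ _ _] := uS n; rewrite un.
have uH n : H (yy (u n)) by have [] := svalP (u n).
have ukE n : act (kk (u n)) (f (yy (u n))) = f y0 by have [] := svalP (u n).
have fib n : generic_fiber (yy (u n)) by apply: LF => j _; exact: HL.
have fiboo : generic_fiber yoo by apply: LF => j _; exact: yooL.
have [|h _ [hD hDoo]] := comeager_nonempty pG openT (ex_intro _ 1%g I) (A :=
      [set h | forall n j, D j (yy (u n), (h * kk (u n))%g)] `&`
      [set h | forall j, D j (yoo, (h * k)%g)]).
  apply: comeagerS (comeagerI (comeager_forall (fun n =>
    generic_fiber_translate (kk (u n)) (fib n))) (generic_fiber_translate k
      fiboo)).
  by move=> h [? ?] _; split.
have FE n : F (yy (u n), (h * kk (u n))%g) = act h (f y0).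
  by rewrite /F /= actM ukE.
(* Were the value at the limit different, [F_sep] would separate the limit from the initial pair by
   open sets; but the pairs converge to the limit and [F] is constant along them. *)
have Foo : F (yoo, (h * k)%g) = act h (f y0).
  apply: contrapT; rewrite -(FE 0%N) => /(F_sep hDoo (hD 0%N))[j [l [Oj Ol
    jl]]].
  have yl : (fun n => yy (u n)) @ \oo --> yoo.
    by apply: cvg_agree => i; exists (row i).+1 => // n /= /yooE.
  have hl : (fun n => (h * kk (u n))%g) @ \oo --> (h * k)%g.
    apply: (@cvg_comp _ _ _ (kk \o u) (fun k => (h * k)%g) _ _ _ kl).
    by apply: (@mulg_continuous2 G G (fun=> h) id) => x;
      [exact: cvg_cst|exact: cvg_id].
  have [|N _ NO] := cvg_pair yl hl (t := O j).
    have : open (O j) by [].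
    by rewrite openE => /(_ _ Oj).
  have := NO N (leqnn N) => /= OjN.
  by apply: (jl _ _ (hD N) (hD 0%N) OjN Ol); rewrite !FE.
have : E1 yoo y0.
  apply/fE; exists k; have := congr1 (act h^-1%g) Foo.
  by rewrite /F /= -!actM mulgA mulVg mul1g act1.
move=> [n nP].
(* Row [n] was changed at step [n] and at no other, so the limit differs from [y0] there. *)
have [_ _ _ _ [_ [i]]] := uS n; rewrite un => rin; rewrite yooE ?rin//; apply.
rewrite nP ?rin// (@urow 0%N) ?u0// => j /andP[_ jn] rij.
by rewrite -rij rin ltnn in jn.
Qed.

End orbit_reduction.

Lemma E1_not_orbit (R : realType) (G : topologicalGroupType)
    (X : topologicalType) (act : G -> X -> X) :
  polish_space R G -> polish_space R X -> borel_action act ->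
  ~ borel_reducible E1 (orbit_equiv act).
Proof.
move=> /polish_space_based pG /polish_space_based pX [actP bact] [f bf fE].
have [bG [_ [bbG _ _ _]]] := pG; have [bX [_ [bbX _ _ _]]] := pX.
have bF : borel_fun (fun p : {ptws nat -> bool} * G => act p.2 (f p.1)).
  have c1 := continuous_borel_fun (@fst_continuous {ptws nat -> bool} G).
  have c2 := continuous_borel_fun (@snd_continuous {ptws nat -> bool} G).
  exact: borel_fun_comp (borel_fun_pair bbG bbX c2 (borel_fun_comp c1 bf)) bact.
have [D [ O [DP oO DO]]] := borel_fun_continuous_comeager bbX bF.
exact: (E1_orbit_absurd pG pX actP fE bbX DP oO DO).
Qed.

(** * E1 reduces to l_oo *)

Section E1_linfty.
Context (R : realType).
Local Notation Y := {ptws nat -> bool}.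

(** One more than the last row in which [x] disagrees with the finite word [w], and 0 without
    disagreement. *)
Definition row_defect (x : Y) (w : seq bool) : nat :=
  \max_(i < size w | x i != nth false w i) (row i).+1.

(** A disagreement of [x] with [w] in a row from [n] on is one of [y] too; the earlier rows
    contribute at most [n]. *)
Lemma row_defect_le (x y : Y) n w : (forall i, (n <= row i)%N -> x i = y i) ->
  (row_defect x w <= n + row_defect y w)%N.
Proof.
move=> xy; apply/bigmax_leqP => i xw; have [ni|ni] := leqP n (row i).
  apply: leq_trans (leq_addl _ _).
  by apply: (bigop.bigmax_sup i) => //; rewrite -xy.
exact: leq_trans ni (leq_addr _ _).
Qed.

Lemma row_defect_mkseq (x : Y) n : row_defect x (mkseq x n) = 0%N.
Proof.
apply/eqP; rewrite -leqn0; apply/bigmax_leqP => i; rewrite nth_mkseq ?eqxx//.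
by apply: leq_trans (ltn_ord i) _; rewrite size_mkseq.
Qed.

Definition E1_to_linfty (x : Y) : real_sequences R :=
  fun n => if unpickle n is Some w then (row_defect x w)%:R else 0.

Lemma E1_to_linfty_continuous : continuous E1_to_linfty.
Proof.
move=> x; apply/cvg_sup => n U [_ [[W oW <-] /= Wx WU]].
rewrite nbhs_simpl /=.
pose w : seq bool := odflt [::] (unpickle n).
apply: filterS (nbhs_agree x (iota 0 (size w))) => y yx; apply: WU => /=.
suff -> : E1_to_linfty y n = E1_to_linfty x n by [].
rewrite /E1_to_linfty; move: @w yx; case: unpickle => //= w yx.
congr _%:R; apply: eq_bigl => i.
by rewrite yx// mem_iota /= add0n.
Qed.

Lemma E1_linfty : borel_reducible E1 (@linfty_equiv R).
Proof.
exists E1_to_linfty.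
  by apply: continuous_borel_fun; exact: E1_to_linfty_continuous.
move=> x y; split=> [[n xy]|[M xyM]].
  exists n.+1%:R => k; rewrite /E1_to_linfty; case: unpickle => [w|];
    last first.
    by rewrite subrr normr0 ltr0n.
  have yx i : (n <= row i)%N -> y i = x i by move=> /xy.
  have := row_defect_le w xy; have := row_defect_le w yx.
  rewrite -!(ler_nat R) !natrD => yx' xy'; rewrite ltr_norml -natr1.
  by apply/andP; split; lra.
(* A prefix of [x] reaching a disagreement at [i] has defect 0 for [x] but more than [row i] for
   [y], which would exceed [M]. *)
exists (Num.truncn M).+1 => i Mi; apply/eqP; apply: contraT => xyi.
have := xyM (pickle (mkseq x i.+1)).
rewrite /E1_to_linfty pickleK row_defect_mkseq sub0r normrN normr_nat => defM.
have : (row i < row_defect y (mkseq x i.+1))%N.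
  have isz : (i < size (mkseq x i.+1))%N by rewrite size_mkseq.
  by apply: (bigop.bigmax_sup (Ordinal isz)) => //=; rewrite nth_mkseq// eq_sym.
move=> /ltnW/(leq_trans Mi); rewrite -(ler_nat R) => Mdef.
have := lt_trans (le_lt_trans Mdef defM) (truncnS_gt M).
by rewrite ltxx.
Qed.

End E1_linfty.

(** * Graph isomorphism as an orbit equivalence relation *)

Definition inverse_pairs : set ({ptws nat -> nat} * {ptws nat -> nat}) :=
  [set p | cancel p.1 p.2 /\ cancel p.2 p.1].

(* The permutation group of [nat], a permutation being paired with its inverse
   so that the pairs form a closed set of sequences. *)
Definition Sinf : Type := inverse_pairs.
HB.instance Definition _ := Topological.on Sinf.

Definition sperm (g : Sinf) : nat -> nat := (val g).1.
Definition spermV (g : Sinf) : nat -> nat := (val g).2.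

Lemma spermK g : cancel (sperm g) (spermV g).
Proof. by have := valP g; rewrite inE => -[]. Qed.

Lemma spermVK g : cancel (spermV g) (sperm g).
Proof. by have := valP g; rewrite inE => -[]. Qed.

Definition mkSinf (f g : nat -> nat) (fK : cancel f g) (gK : cancel g f) :
    Sinf :=
  exist _ (f, g) (mem_set (conj fK gK)).

Lemma Sinf_eqP (g h : Sinf) : sperm g =1 sperm h -> g = h.
Proof.
move=> gh; apply: val_inj;
  rewrite [val g]surjective_pairing [val h]surjective_pairing.
congr pair; first exact/funext.
apply/funext => i; change (spermV g i = spermV h i).
by rewrite -{1}(spermVK h i) -gh spermK.
Qed.

Definition Sinf1 : Sinf :=
  mkSinf (f := id) (g := id) (fun=> erefl) (fun=> erefl).
Definition SinfV (g : Sinf) : Sinf := mkSinf (spermVK g) (spermK g).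
Definition SinfM (g h : Sinf) : Sinf :=
  mkSinf (can_comp (spermK g) (spermK h)) (can_comp (spermVK h) (spermVK g)).

Lemma SinfMA : associative SinfM. Proof. by move=> *; exact: Sinf_eqP. Qed.
Lemma Sinf1M : left_id Sinf1 SinfM. Proof. by move=> *; exact: Sinf_eqP. Qed.
Lemma SinfM1 : right_id Sinf1 SinfM. Proof. by move=> *; exact: Sinf_eqP. Qed.
Lemma SinfVM : left_inverse Sinf1 SinfV SinfM.
Proof. by move=> g; apply: Sinf_eqP => i; exact: spermK. Qed.
Lemma SinfMV : right_inverse Sinf1 SinfV SinfM.
Proof. by move=> g; apply: Sinf_eqP => i; exact: spermVK. Qed.

HB.instance Definition _ :=
  isGroup.Build Sinf SinfMA Sinf1M SinfM1 SinfVM SinfMV.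

Lemma continuous_set_type (X Z : topologicalType) (A : set X) (f : Z -> A) :
  continuous (fun z => val (f z)) -> continuous f.
Proof.
move=> cf z V /nbhs_set_type[W fW WV].
have cW : nbhs z ((fun z => val (f z)) @^-1` W) by exact: cf.
by apply: filterS cW => w; exact: WV.
Qed.

Lemma ptws_comp_continuous :
  continuous (fun p : {ptws nat -> nat} * {ptws nat -> nat} =>
    (p.1 \o p.2 : {ptws nat -> nat})).
Proof.
move=> [a b] V /nbhs_agreeP[s sV]; rewrite nbhs_simpl /=.
exists ([set a' : {ptws nat -> nat} | forall i, i \in map b s -> a' i = a i],
        [set b' : {ptws nat -> nat} | forall i, i \in s -> b' i = b i]).
  by split; exact: nbhs_agree.
move=> [a' b'] [/= aa' bb']; apply: sV => i i_s /=.
by rewrite bb'// aa'// map_f.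
Qed.

Lemma sperm_continuous : continuous (sperm : Sinf -> {ptws nat -> nat}).
Proof. exact: continuous_compT (@continuous_val _ _) (@fst_continuous _ _). Qed.

Lemma spermV_continuous : continuous (spermV : Sinf -> {ptws nat -> nat}).
Proof. exact: continuous_compT (@continuous_val _ _) (@snd_continuous _ _). Qed.

Lemma SinfM_continuous : continuous (fun gh : Sinf * Sinf => (gh.1 * gh.2)%g).
Proof.
have c1 := @fst_continuous Sinf Sinf; have c2 := @snd_continuous Sinf Sinf.
apply: continuous_set_type; apply: continuous_pair.
  exact: continuous_compT (continuous_pair (continuous_compT c1
    sperm_continuous)
    (continuous_compT c2 sperm_continuous)) ptws_comp_continuous.
exact: continuous_compT (continuous_pair (continuous_compT c2 spermV_continuous)
    (continuous_compT c1 spermV_continuous)) ptws_comp_continuous.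
Qed.

Lemma SinfV_continuous : continuous (fun g : Sinf => (g^-1)%g).
Proof.
apply: continuous_set_type.
exact: continuous_pair spermV_continuous sperm_continuous.
Qed.

HB.instance Definition _ :=
  isTopologicalGroup.Build Sinf SinfM_continuous SinfV_continuous.

(** The identity [b (a i) = i] involves two values only, shared with some inverse pair close to
    [(a, b)]. *)
Lemma closed_inverse_pairs : closed inverse_pairs.
Proof.
move=> [a b] ab.
have near i j : exists p : {ptws nat -> nat} * {ptws nat -> nat},
    [/\ inverse_pairs p, p.1 i = a i & p.2 j = b j].
  have [|p [abp [/= pa pb]]] :=
      ab ([set a' : {ptws nat -> nat} | forall k, k \in [:: i] -> a' k = a k]
        `*`
          [set b' : {ptws nat -> nat} | forall k, k \in [:: j] -> b' k = b k]).
    exists ([set a' : {ptws nat -> nat} | forall k, k \in [:: i] -> a' k = a k],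
          [set b' : {ptws nat -> nat} | forall k, k \in [:: j] -> b' k = b k])
            => //.
    by split; exact: nbhs_agree.
  by exists p; rewrite pa ?pb ?mem_seq1.
split=> i /=.
  by have [p [[pK _] <- <-]] := near i (a i); rewrite pK.
by have [p [[_ pK] <- <-]] := near (b i) i; rewrite pK.
Qed.

Lemma closed_countable_graphs : closed countable_graphs.
Proof.
move=> e ce; split=> [i|i j].
  have [e' [[ei _] /= ee']] := ce _ (nbhs_agree e [:: (i, i)]).
  by rewrite -ee' ?mem_seq1.
have [e' [[_ ee] /= ee']] := ce _ (nbhs_agree e [:: (i, j); (j, i)]).
have e12 : e' (i, j) = e (i, j) by apply: ee'; exact: mem_head.
have e21 : e' (j, i) = e (j, i).
  by apply: ee'; rewrite in_cons mem_seq1 eqxx orbT.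
by rewrite -e12 -e21; exact: ee.
Qed.

(** Edges are read through the inverse permutation, which makes this a left action. *)
Definition graph_act (g : Sinf) (e : countable_graphs) : countable_graphs.
Proof.
refine (exist _ (fun p => val e (spermV g p.1, spermV g p.2)) _).
have := valP e; rewrite !inE => -[e1 e2].
by split=> [i|i j] /=; [exact: e1|exact: e2].
Defined.

Lemma graph_act_borel : borel_action graph_act.
Proof.
split.
  split=> [e|g h e]; apply: val_inj; apply/funext => -[i j] //=.
apply: continuous_borel_fun; apply: continuous_set_type.
move=> [g e] V /nbhs_agreeP[s sV]; rewrite nbhs_simpl /=.
pose w := [seq p.1 | p <- s] ++ [seq p.2 | p <- s].
pose Pg := [set a : {ptws nat -> nat} | forall i, i \in w -> a i = spermV g i].
pose Pe := [set e' : {ptws (nat * nat)%type -> bool} | forall p,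
  p \in [seq (spermV g q.1, spermV g q.2) | q <- s] -> e' p = val e p].
exists (spermV @^-1` Pg,
  (val : countable_graphs -> {ptws (nat * nat)%type -> bool}) @^-1` Pe).
  split; first by apply: spermV_continuous; exact: nbhs_agree.
  by apply: continuous_val; exact: nbhs_agree.
move=> [g' e'] [/= gg' ee']; apply: sV => p ps /=.
have -> : spermV g' p.1 = spermV g p.1.
  by apply: gg'; rewrite mem_cat (map_f fst ps).
have -> : spermV g' p.2 = spermV g p.2.
  by apply: gg'; rewrite mem_cat (map_f snd ps) orbT.
by apply: ee'; apply: (map_f (fun q => (spermV g q.1, spermV g q.2))).
Qed.

Lemma graph_iso_orbit (e1 e2 : countable_graphs) :
  graph_iso e1 e2 <-> orbit_equiv graph_act e1 e2.
Proof.
split=> [[f [g fK gK] fE]|[g <-]].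
  exists (mkSinf fK gK); apply: val_inj; apply/funext => -[i j] /=.
  by rewrite fE !gK.
exists (sperm g); first by exists (spermV g); [exact: spermK|exact: spermVK].
by move=> i j /=; rewrite !spermK.
Qed.

Lemma polish_Sinf (R : realType) : polish_space R Sinf.
Proof.
have pN : polish_based R {ptws nat -> nat}.
  exact: (@polish_based_discrete_product R nat nat id).
apply: polish_based_space.
exact: polish_based_set_type closed_inverse_pairs (polish_based_prod pN pN).
Qed.

Lemma polish_countable_graphs (R : realType) : polish_space R countable_graphs.
Proof.
apply: polish_based_space;
  apply: polish_based_set_type closed_countable_graphs _.
by apply: (@polish_based_discrete_product R _ bool nat_of_bool) => -[] [].
Qed.

(** * Blocks and their Cantor-Bendixson ranks *)

Section nonzero_letters.
Implicit Types (r : nat -> nat) (s : seq nat).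

Definition nz s := [seq a <- s | a != 0%N].
Definition cnt r n := size (nz (mkseq r n)).
(** The default 0 means that no nonzero letter has occurred yet. *)
Definition hd r n := head 0%N (nz (mkseq r n)).

Lemma mkseqP r r' n :
  mkseq r n = mkseq r' n <-> forall i, (i < n)%N -> r i = r' i.
Proof.
split=> [rr' i i_n|rr']; first by rewrite -(nth_mkseq 0%N r i_n) rr' nth_mkseq.
by apply/eq_in_map => i; rewrite mem_iota => /andP[_ /rr'].
Qed.

Lemma mkseq_le r r' n m :
  (n <= m)%N -> mkseq r m = mkseq r' m -> mkseq r n = mkseq r' n.
Proof. by move=> nm /mkseqP rr'; apply/mkseqP => i i_n;
  rewrite rr'// (leq_trans i_n). Qed.

Lemma cntS r n : cnt r n.+1 = (cnt r n + (r n != 0%N))%N.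
Proof.
by rewrite /cnt mkseqS /nz filter_rcons; case: ifP => /=;
  rewrite ?size_rcons ?addn1 ?addn0.
Qed.

Lemma cnt_le r n m : (n <= m)%N -> (cnt r n <= cnt r m)%N.
Proof.
move=> /subnK <-; elim: (m - n)%N => // k IH.
by rewrite addSn cntS (leq_trans IH)// leq_addr.
Qed.

Lemma head_nz s : (head 0%N (nz s) == 0%N) = nilp (nz s).
Proof.
have : all (fun a => a != 0%N) (nz s) by exact: filter_all.
by case: (nz s) => //= a t /andP[/negPf->].
Qed.

Lemma hdS r n : hd r n.+1 = if hd r n != 0%N then hd r n else r n.
Proof.
rewrite /hd mkseqS head_nz [in LHS]/nz filter_rcons -/(nz _).
by case: ifP => [_|/negbFE/eqP->]; case: (nz _).
Qed.

Lemma hd_cnt r n : (hd r n == 0%N) = (cnt r n == 0%N).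
Proof. exact: head_nz. Qed.

Lemma hd_stable r n m : (n <= m)%N -> hd r n != 0%N -> hd r m = hd r n.
Proof.
move=> /subnK <- rn; elim: (m - n)%N => // k IH.
by rewrite addSn hdS IH rn.
Qed.

Definition odd_head r : Prop := exists n, odd (hd r n).

Lemma odd_hd_le r n m : (n <= m)%N -> odd (hd r n) -> odd (hd r m).
Proof. by move=> nm on; rewrite (hd_stable nm)//; case: (hd r n) on. Qed.

Lemma cnt_eq_agree r r' n : mkseq r n = mkseq r' n -> cnt r n = cnt r' n.
Proof. by rewrite /cnt => ->. Qed.

Lemma hd_eq_agree r r' n : mkseq r n = mkseq r' n -> hd r n = hd r' n.
Proof. by rewrite /hd => ->. Qed.

Definition bump_at r j c : nat -> nat := fun i => (r i + (i == j) * c)%N.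

Lemma bump_agree r j c n : (n <= j)%N -> mkseq (bump_at r j c) n = mkseq r n.
Proof.
move=> nj; apply/mkseqP => i i_n; rewrite /bump_at.
by rewrite ltn_eqF ?addn0// (leq_trans i_n).
Qed.

Lemma bump_neq r j c : (0 < c)%N -> bump_at r j c <> r.
Proof.
move=> c0 /(congr1 (fun u => u j)); rewrite /bump_at eqxx mul1n => /eqP.
by rewrite -{2}[r j]addn0 eqn_add2l; case: c c0.
Qed.

Lemma cnt_bump r j c n : (cnt (bump_at r j c) n <= (cnt r n).+1)%N.
Proof.
have le n' : (n' <= j)%N -> cnt (bump_at r j c) n' = cnt r n'.
  by move=> n'j; apply: cnt_eq_agree; exact: bump_agree.
have [nj|jn] := leqP n j; first by rewrite le.
move: jn => /subnK <-; elim: (n - j.+1)%N => [|k IH].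
  by rewrite add0n !cntS le// -addnS leq_add2l (leq_trans (leq_b1 _)).
have -> : (k.+1 + j.+1 = (k + j.+1).+1)%N by lia.
have kj : (k + j.+1 == j)%N = false by apply/eqP; lia.
by rewrite !cntS {2}/bump_at kj addn0 -addSn leq_add2r.
Qed.

(** The first [j] letters of [r], then [a] ones, then zeros. *)
Definition fill r j a : nat -> nat :=
  fun i => if (i < j)%N then r i else (i < j + a)%N : nat.

Lemma fill_agree r j a n : (n <= j)%N -> mkseq (fill r j a) n = mkseq r n.
Proof. by move=> nj; apply/mkseqP => i i_n; rewrite /fill (leq_trans i_n). Qed.

Lemma cnt_fillE r j a k :
  (k <= a)%N -> cnt (fill r j a) (k + j) = (cnt r j + k)%N.
Proof.
elim: k => [_|k IH ka]; first by rewrite addn0 add0n; apply: cnt_eq_agree;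
  exact: fill_agree.
rewrite addSn cntS IH ?(ltnW ka)//.
have -> : fill r j a (k + j) = 1%N.
  by rewrite /fill ltnNge leq_addl /= addnC ltn_add2l ka.
by rewrite addn1 addnS.
Qed.

Lemma cnt_fill r j a n : (cnt (fill r j a) n <= cnt r j + a)%N.
Proof.
have [nja|jan] := leqP n (a + j).
  by rewrite -(cnt_fillE r j (leqnn a)) cnt_le.
move: jan => /ltnW/subnK <-; elim: (n - (a + j))%N => [|k IH].
  by rewrite add0n cnt_fillE.
have f0 : fill r j a (k + (a + j)) = 0%N.
  rewrite /fill; have -> : (k + (a + j) < j)%N = false by lia.
  by have -> : (k + (a + j) < j + a)%N = false by lia.
by rewrite addSn cntS f0 addn0.
Qed.

End nonzero_letters.

(** * Ranks of the points of the blocks and the characterisation of the base points *)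

Section rigidity.
Local Notation point := (nat * (nat -> nat))%type.
Implicit Types (z w : point) (A : set point).

(** A word with even first nonzero letter continues freely, which gives the perfect part; an odd one
    allows [q + 1] nonzero letters in all, which bounds the ranks by [q]. *)
Definition block q (s : seq nat) : bool :=
  if nz s is a :: t then ~~ odd a || (size t <= q)%N else true.

Lemma blockE q r n :
  block q (mkseq r n) = ~~ odd (hd r n) || (cnt r n <= q.+1)%N.
Proof. by rewrite /block /hd /cnt; case: nz. Qed.

(* The points of the disjoint union over [q] of the bodies of the trees
   [block q]; [sim k z w] says that [w] is in the [k]-th neighbourhood of [z].
     *)
Definition block_points : set point :=
  [set z | forall n, block z.1 (mkseq z.2 n)].

Definition sim k z w : Prop := z.1 = w.1 /\ mkseq z.2 k = mkseq w.2 k.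

Definition isolated A z : Prop :=
  A z /\ exists j, forall w, A w -> sim j z w -> w = z.

Definition adherent A z : Prop := forall j, exists2 w, A w & sim j z w.

Fixpoint derived k : set point :=
  if k is k'.+1 then [set z | derived k' z /\ ~ isolated (derived k') z]
  else block_points.

(** Phrased through derivatives and adherence alone, hence invariant under homeomorphisms. *)
Definition marked q : set point :=
  [set z | [/\ block_points z, adherent (isolated (derived q)) z,
    ~ isolated (derived q) z & ~ adherent (isolated (derived q.+1)) z]].

Definition base_point q : point := (q, fun=> 0%N).

Lemma block_pointsP z : block_points z <->
  (odd_head z.2 -> forall n, (cnt z.2 n <= z.1.+1)%N).
Proof.
split=> [Sz [n0 on0] n|Sz n].
  have := Sz (maxn n0 n); rewrite blockE (odd_hd_le _ on0) ?leq_maxl//=.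
  by apply: leq_trans; rewrite cnt_le ?leq_maxr.
by rewrite blockE; case: (boolP (odd _)) => //= on; apply: Sz; exists n.
Qed.

(** The explicit form of [derived k]: after an odd first letter, at least [k] of the [q + 1]
    admissible nonzero letters are left over. *)
Definition low_count k z : Prop :=
  odd_head z.2 -> forall n, (cnt z.2 n + k <= z.1.+1)%N.

Definition full_count k z : Prop :=
  [/\ odd_head z.2, low_count k z & exists n, (cnt z.2 n + k = z.1.+1)%N].

(** A prefix that shows the odd head and attains the maximal count forces all later letters to
    vanish, so it determines the point. *)
Lemma full_count_isolated k z :
  full_count k z -> isolated (low_count k) z.
Proof.
case: z => q r [/= [n0 on0] lz [n1 en1]]; split => //.
exists (maxn n0 n1) => -[q' r'] lw [/= qq' rr']; rewrite -{q'}qq' in lw *.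
set N := maxn n0 n1 in rr' *; congr pair;
  have on : odd (hd r N) by rewrite (odd_hd_le _ on0)// leq_maxl.
have {}lw n : (cnt r' n + k <= q.+1)%N.
  by apply: lw; exists N; rewrite -(hd_eq_agree rr').
have {}lz n : (cnt r n + k <= q.+1)%N by apply: lz; exists n0.
have cN : (cnt r N + k = q.+1)%N.
  by apply/eqP; rewrite eqn_leq lz -en1 leq_add2r cnt_le ?leq_maxr.
have zero u i : cnt u N = cnt r N -> (forall n, (cnt u n + k <= q.+1)%N) ->
    (N <= i)%N -> u i = 0%N.
  move=> uN uk Ni; apply/eqP; apply: contraT => ui.
  by have := uk i.+1; rewrite cntS ui; have := cnt_le u Ni; lia.
apply/funext => i; have [iN|Ni] := ltnP i N.
  by move/mkseqP: rr' => /(_ _ iN).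
by rewrite (zero r' i (esym (cnt_eq_agree rr')) lw Ni) (zero r i erefl lz Ni).
Qed.

(** Changing one far letter gives another point nearby: with an odd head there is room for one more
    nonzero letter, with an even head nothing is bounded, and without a head a letter 2 creates an
    even one. *)
Lemma isolated_full_count k z : low_count k z -> ~ full_count k z ->
  ~ isolated (low_count k) z.
Proof.
case: z => q r lz nf [_ [j jP]].
have [oz|noz] := pselect (odd_head r).
  have [n0 on0] := oz; pose J := maxn j n0.
  suff : (q, bump_at r J 1) = (q, r) by move=> /(congr1 snd); exact: bump_neq.
  apply: jP.
    move=> _ n /=; apply: leq_trans (leq_add (cnt_bump _ _ _ _) (leqnn k)) _.
    rewrite addSn ltn_neqAle lz// andbT; apply/negP => /eqP e; apply: nf.
    by split => //; exists n.
  by split => //=; rewrite bump_agree// leq_maxl.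
have [[n0 n0P]|z0] := pselect (exists n, hd r n != 0%N).
  pose J := maxn j n0.
  suff : (q, bump_at r J 1) = (q, r) by move=> /(congr1 snd); exact: bump_neq.
  apply: jP.
    move=> [m om]; exfalso; apply: noz.
    exists n0; have hJ : hd (bump_at r J 1) n0 = hd r n0.
      by apply: hd_eq_agree; rewrite bump_agree// leq_maxr.
    have hJ0 : hd (bump_at r J 1) n0 != 0%N by rewrite hJ.
    have := odd_hd_le (leq_maxl m n0) om.
    by rewrite (hd_stable (leq_maxr m n0) hJ0) hJ.
  by split => //=; rewrite bump_agree// leq_maxl.
suff : (q, bump_at r j 2) = (q, r) by move=> /(congr1 snd); exact: bump_neq.
  apply: jP.
  have hr n : hd r n = 0%N by apply/eqP; apply: contraT => rn; case: z0;
    exists n.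
  move=> [m om]; exfalso; have [mj|jm] := leqP m j.
    by move: om; rewrite (hd_eq_agree (bump_agree _ _ mj)) hr.
  have : hd (bump_at r j 2) j.+1 = 2%N.
    have rj : r j = 0%N by have := hdS r j; rewrite !hr.
    by rewrite hdS (hd_eq_agree (bump_agree _ _ (leqnn j))) hr /bump_at !eqxx
      rj.
  by move=> h2; move: om; rewrite (hd_stable jm) h2.
by split => //=; rewrite bump_agree.
Qed.

Lemma derivedE k : derived k = low_count k.
Proof.
elim: k => [|k IH].
  apply/seteqP; split=> z /=.
    by move=> /block_pointsP zP oz n; rewrite addn0; exact: zP.
  by move=> zP; apply/block_pointsP => oz n; have := zP oz n; rewrite addn0.
rewrite /= IH; apply/seteqP; split=> z /=.
  move=> [lz ni] oz n; rewrite addnS ltn_neqAle lz// andbT;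
    apply/negP => /eqP e.
  by apply: ni; apply: full_count_isolated; split => //; exists n.
move=> lz; split; first by move=> oz n; rewrite (leq_trans _ (lz oz n))// addnS.
apply: isolated_full_count; first by move=> oz n;
  rewrite (leq_trans _ (lz oz n))// addnS.
by move=> [oz _ [n en]]; have := lz oz n; rewrite addnS en ltnn.
Qed.

Lemma isolatedE k : isolated (derived k) = full_count k.
Proof.
rewrite derivedE; apply/seteqP; split=> z; last exact: full_count_isolated.
by move=> iz; apply: contrapT => nf; have [lz _] := iz;
  exact: isolated_full_count nf iz.
Qed.

(** Ones fill up the count exactly; when [r] has no nonzero letter the first of them is the odd
    head, whence [0 < a]. *)
Lemma full_count_fill q r j a k :
  (odd_head r -> (exists2 n, (n <= j)%N & odd (hd r n))) ->
  odd_head r \/ ((forall n, hd r n = 0%N) /\ (0 < a)%N) ->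
  (cnt r j + a + k = q.+1)%N -> full_count k (q, fill r j a).
Proof.
move=> rj ro e; have cE : (cnt (fill r j a) (a + j) + k = q.+1)%N by rewrite
  cnt_fillE.
split => /=; last 1 first.
- by exists (a + j)%N.
- case: ro => [/rj[n nj on]|[r0 a0]].
    by exists n; rewrite (hd_eq_agree (fill_agree _ _ nj)).
  exists j.+1; rewrite hdS (hd_eq_agree (fill_agree _ _ (leqnn j))) r0 /= /fill
    ltnn.
  by rewrite -[X in (X < _)%N]addn0 ltn_add2l a0.
- by move=> _ n /=; rewrite -e leq_add2r cnt_fill.
Qed.

Lemma marked_base_point q : marked q (base_point q).
Proof.
have h0 n : hd (fun=> 0%N) n = 0%N by elim: n => // n IH; rewrite hdS IH.
have c0 n : cnt (fun=> 0%N) n = 0%N by apply/eqP; rewrite -hd_cnt h0.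
have no : ~ odd_head (fun=> 0%N) by move=> [n]; rewrite h0.
split; rewrite ?isolatedE.
- by apply/block_pointsP.
- move=> j; exists (q, fill (fun=> 0%N) j 1).
    by apply: full_count_fill => //; [right|rewrite c0 add0n add1n].
  by split => //=; rewrite fill_agree.
- by case.
(* A point of rank [q + 1] in block [q] would have an odd head and yet no nonzero letter. *)
- move=> /(_ 0%N)[[q' r] + [/= qq' _]]; rewrite -{}qq' => -[/= [n on] lz _].
  have := lz (ex_intro _ n on) n;
    rewrite /= -[X in (_ <= X)%N]add0n leq_add2r leqn0 -hd_cnt.
  by move=> /eqP h; rewrite h in on.
Qed.

Lemma marked_unique q z : marked q z -> z = base_point q.
Proof.
case: z => q0 r [Sz az niz naz]; move: az niz naz;
  rewrite !isolatedE => az niz naz.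
(* If [r] has a nonzero letter, adherence to rank [q] makes its head odd; as [r] itself lacks rank
   [q], filling up its count yields nearby points of rank [q + 1]. *)
have [[n0 n0P]|r0] := pselect (exists n, hd r n != 0%N).
  exfalso.
  have [n1 on1] : odd_head r.
    have [[_ r'] [/= [m om] _ _] [/= _ rr']] := az n0; exists n0.
    have e := hd_eq_agree rr'; rewrite e in n0P *.
    by have := odd_hd_le (leq_maxl m n0) om;
      rewrite (hd_stable (leq_maxr m n0)).
  have lz n : (cnt r n + q <= q0.+1)%N.
    have [[q' r'] [/= or' lr' _] [/= qq' rr']] := az n.
    by have := lr' or' n; rewrite /= -(cnt_eq_agree rr') -qq'.
  have lz' n : (cnt r n + q.+1 <= q0.+1)%N.
    rewrite addnS ltn_neqAle lz andbT; apply/negP => /eqP e; apply: niz.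
    by split => //=; [exists n1|exists n].
  apply: naz => j; pose J := maxn j n1; pose a := (q0.+1 - (cnt r J + q.+1))%N.
  exists (q0, fill r J a).
    apply: full_count_fill; first by move=> _; exists n1 => //;
      rewrite leq_maxr.
      by left; exists n1.
    by rewrite addnAC subnKC// lz'.
  by split => //=; rewrite fill_agree// leq_maxl.
have hr n : hd r n = 0%N by apply/eqP; apply: contraT => rn; case: r0; exists n.
have c0 n : cnt r n = 0%N by apply/eqP; rewrite -hd_cnt hr.
have -> : r = fun=> 0%N.
  by apply/funext => n; have := hdS r n; rewrite !hr.
suff -> : q0 = q by [].
apply/eqP; rewrite eqn_leq; apply/andP; split; last first.
  have [[q' r'] [/= [m om] lr' _] [/= qq' _]] := az 0%N.
  have cm : (0 < cnt r' m)%N.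
    by rewrite lt0n -hd_cnt; apply/eqP => h; rewrite h in om.
  by have := lr' (ex_intro _ m om) m; rewrite /= -qq'; lia.
(* If [q < q0], then [q0 - q] ones placed far out give points of rank [q + 1] near the zero sequence
   of block [q0]. *)
rewrite leqNgt; apply/negP => qq0; apply: naz => j.
exists (q0, fill r j (q0 - q)).
  apply: full_count_fill; first by move=> [n]; rewrite hr.
    by right; split => //; rewrite subn_gt0.
  by rewrite c0 add0n addnS subnK// ltnW.
by split => //=; rewrite fill_agree.
Qed.

(** * Homeomorphisms of the union of the blocks *)

Definition sim_continuous (h : point -> point) : Prop :=
  forall z, block_points z -> forall k, exists j,
    forall w, block_points w -> sim j z w -> sim k (h z) (h w).

Definition sim_homeo (h h' : point -> point) : Prop :=
  [/\ forall z, block_points z -> block_points (h z),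
      forall z, block_points z -> h' (h z) = z & sim_continuous h].

Lemma derived_points k z : derived k z -> block_points z.
Proof. by elim: k z => //= k IH z [/IH]. Qed.

Section homeo.
Context (h h' : point -> point) (hH : sim_homeo h h') (hH' : sim_homeo h' h).

Lemma isolated_homeo A : (forall z, A z -> block_points z) ->
  (forall z, A z -> A (h z)) -> (forall z, A z -> A (h' z)) ->
  forall z, isolated A z -> isolated A (h z).
Proof.
move=> AS Ah Ah' z [Az [j jP]]; split; first exact: Ah.
have [hS hK hc] := hH; have [hS' hK' hc'] := hH'.
have [l lP] := hc' (h z) (hS _ (AS _ Az)) j.
exists l => w Aw hzw; rewrite -(hK' _ (AS _ Aw)); congr h.
apply: jP; first exact: Ah'.
by have := lP w (AS _ Aw) hzw; rewrite hK//; exact: AS.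
Qed.

End homeo.

(** Quantified over both maps so that the induction can exchange [h] and [h']. *)
Lemma derived_homeo k h h' : sim_homeo h h' -> sim_homeo h' h ->
  forall z, derived k z -> derived k (h z).
Proof.
elim: k h h' => [h h' [hS _ _] _ //|k IH h h' hH hH' z /= [dz niz]].
split; first exact: IH hH hH' _ dz.
move=> ihz; apply: niz.
have -> : z = h' (h z).
  by have [_ hK _] := hH; rewrite hK//; exact: derived_points dz.
apply: (isolated_homeo hH' hH) => //.
- exact: derived_points.
- exact: IH hH' hH.
- exact: IH hH hH'.
Qed.

Lemma isolated_derived_homeo k h h' : sim_homeo h h' -> sim_homeo h' h ->
  forall z, isolated (derived k) z -> isolated (derived k) (h z).
Proof.
move=> hH hH'; apply: (isolated_homeo hH hH').
- exact: derived_points.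
- exact: derived_homeo hH hH'.
- exact: derived_homeo hH' hH.
Qed.

Lemma adherent_homeo k h h' : sim_homeo h h' -> sim_homeo h' h ->
  forall z, block_points z -> adherent (isolated (derived k)) z ->
  adherent (isolated (derived k)) (h z).
Proof.
move=> hH hH' z Sz az l; have [_ _ hc] := hH; have [j jP] := hc _ Sz l.
have [w iw zw] := az j; exists (h w);
  first exact: isolated_derived_homeo hH hH' _ iw.
by apply: jP => //; have [/derived_points] := iw.
Qed.

Lemma base_point_rigid q h h' : sim_homeo h h' -> sim_homeo h' h ->
  h (base_point q) = base_point q.
Proof.
move=> hH hH'; apply: marked_unique.
have [Sz az niz naz] := marked_base_point q; have [hS hK _] := hH.
have hKz : h' (h (base_point q)) = base_point q by exact: hK.
split; first exact: hS.
- exact: adherent_homeo hH hH' _ Sz az.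
- by move=> /(isolated_derived_homeo hH' hH); rewrite hKz.
- by move=> /(adherent_homeo hH' hH (hS _ Sz)); rewrite hKz.
Qed.

End rigidity.

(** * The coded trees *)

Section coded_tree.
Implicit Types (c : nat -> nat) (x y : nat -> nat).

(** After the letter [p] come [c p] zeros, a bit [e], and a word of block [2p + e]. *)
Definition ctree c (s : seq nat) : bool :=
  if s is p :: t then
    all (pred1 0%N) (take (c p) t) &&
    (if drop (c p) t is e :: u then (e < 2)%N && block (p.*2 + e) u else true)
  else true.

Lemma block_cat q u v : block q (u ++ v) -> block q u.
Proof.
rewrite /block /nz filter_cat; case: (seq.filter _ u) => //= a t /orP[->//|].
by rewrite size_cat => /(leq_trans (leq_addr _ _)) ->; rewrite orbT.
Qed.

Lemma block_rcons0 q u : block q (rcons u 0%N) = block q u.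
Proof. by rewrite /block /nz filter_rcons. Qed.

Lemma ctree_is_tree c : is_tree (ctree c).
Proof.
split; first by exists [::].
move=> [//|p t] _ /prefixP[v ->] /= /andP[z bl]; apply/andP; split.
  move: z; rewrite take_cat; case: ltnP => // tn.
  by rewrite all_cat => /andP[+ _]; rewrite (take_oversize tn).
move: bl; rewrite drop_cat; case: ltnP => [nt|tn];
  last by rewrite (drop_oversize tn).
by case: (drop _ t) => //= e u /andP[-> /block_cat].
Qed.

(** The letter 0 can always be appended: it continues a stem, is a bit, and leaves the nonzero
    letters of a block word unchanged. *)
Lemma ctree_is_pruned c : is_pruned (ctree c).
Proof.
move=> s Ts; exists (rcons s 0%N); split; last 2 first.
- exact: prefix_rcons.
- by apply/eqP => /(congr1 size); rewrite size_rcons => /eqP; rewrite ltn_eqF.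
move: Ts; case: s => [_|p t /= /andP[z bl]]; first by rewrite /= /drop;
  case: (c 0%N).
apply/andP; split.
  rewrite -cats1 take_cat; case: ltnP => // tn.
  by rewrite (take_oversize tn) in z; rewrite all_cat z; case: (_ - _)%N.
rewrite -cats1 drop_cat; case: ltnP => [nt|tn].
  by move: bl; case: (drop _ t) => //= e u; rewrite cats1 block_rcons0.
by case: (_ - _)%N.
Qed.

Definition ctree_pruned c : pruned_trees :=
  exist _ (ctree c) (mem_set (conj (ctree_is_tree c) (@ctree_is_pruned c))).

Local Notation point := (nat * (nat -> nat))%type.

Definition emb c (z : point) : nat -> nat := fun i =>
  if i is i'.+1 then
    if (i' < c z.1./2)%N then 0%N else
    if i' == c z.1./2 then odd z.1 : nat else z.2 (i' - (c z.1./2).+1)%N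
  else z.1./2.

Definition dec c x : point :=
  ((x 0%N).*2 + x (c (x 0%N)).+1, fun i => x (i + (c (x 0%N)).+2))%N.

Lemma embK c z : dec c (emb c z) = z.
Proof.
case: z => q r; rewrite /dec /=; congr pair.
  by rewrite ltnn eqxx addnC odd_double_half.
apply/funext => i; rewrite addnS /=.
have -> : (i + (c q./2).+1 < c q./2)%N = false by lia.
have -> : (i + (c q./2).+1 == c q./2)%N = false by apply/eqP; lia.
by rewrite addnK.
Qed.

Lemma decK c x : (forall i, (i < c (x 0))%N -> x i.+1 = 0)%N ->
  (x (c (x 0)).+1 < 2)%N -> emb c (dec c x) = x.
Proof.
move=> x0 xb; have e : ((x 0).*2 + x (c (x 0)).+1)./2%N = x 0%N.
  by move: (x (c (x 0%N)).+1) xb => [|[|//]] _;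
    rewrite ?addn0 ?doubleK// addn1 /= uphalf_double.
have o : odd ((x 0).*2 + x (c (x 0)).+1)%N = x (c (x 0%N)).+1 :> nat.
  by rewrite oddD odd_double /=; move: (x (c (x 0%N)).+1) xb => [|[|//]].
apply/funext => -[|i]; rewrite /emb /= e//.
case: ltnP => [/x0//|ci]; case: eqP => [->|/eqP ne]; first exact: o.
by congr x; rewrite addnS subnK// ltn_neqAle eq_sym ne.
Qed.

Lemma mkseqSl x n : mkseq x n.+1 = x 0%N :: mkseq (fun i => x i.+1) n.
Proof. by rewrite /mkseq /= -[1%N]addn0 iotaDl -map_comp. Qed.

Lemma drop_mkseq x k n :
  drop k (mkseq x (k + n)) = mkseq (fun i => x (k + i)%N) n.
Proof.
rewrite /mkseq -map_drop drop_iota add0n addKn -[X in iota X _]addn0 iotaDl.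
by rewrite -map_comp.
Qed.

Lemma body_ctree (R : realType) c (x : baire R) : body R (ctree c) x <->
  [/\ forall i, (i < c (x 0))%N -> x i.+1 = 0%N, (x (c (x 0)).+1 < 2)%N &
      block_points (dec c x)].
Proof.
set p := x 0%N; split=> [bx|[x0 xb Sx] [|n]]; last 2 first.
- by [].
- rewrite mkseqSl /= -/p; apply/andP; split.
    apply/(all_nthP 0%N) => i; rewrite size_take size_mkseq => i_.
    have [ic i_n] : (i < c p)%N /\ (i < n)%N by case: ifP i_; lia.
    by rewrite nth_take// nth_mkseq// x0.
  have [nc|cn] := leqP n (c p); first by rewrite drop_oversize// size_mkseq.
  rewrite -(subnKC cn) addSnnS drop_mkseq mkseqSl addn0 xb /=.
  have := Sx (n - (c p).+1)%N; congr block; apply: eq_mkseq => i /=.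
  by congr x; rewrite /p; lia.
have bn n : ctree c (mkseq x n.+1) by exact: bx.
have x0 i : (i < c p)%N -> x i.+1 = 0%N.
  move=> ic; have := bn i.+1; rewrite mkseqSl /= => /andP[/(all_nthP 0%N) + _].
  move=> /(_ i); rewrite size_take size_mkseq -/p;
    have -> : (if (c p < i.+1)%N then c p else i.+1) = i.+1.
    by case: ifP => //; lia.
  by move=> /(_ (ltnSn i)); rewrite nth_take// nth_mkseq// => /eqP.
have tl n : (x (c p).+1 < 2)%N && block (p.*2 + x (c p).+1) (mkseq (fun i => x
  (i + (c p).+2)%N) n).
  have := bn (c p + n.+1)%N; rewrite mkseqSl /= => /andP[_];
    rewrite -/p drop_mkseq mkseqSl addn0.
  move=> /andP[-> b] /=; move: b; congr block; apply: eq_mkseq => i /=.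
  by congr x; lia.
split => //; first by have /andP[] := tl 0%N.
by move=> n; have /andP[] := tl n.
Qed.

Lemma body_emb (R : realType) c z :
  block_points z -> body R (ctree c) (emb c z).
Proof.
move=> Sz; apply/body_ctree; split=> [i|/=|]; last by rewrite embK.
  by rewrite /= => ->.
by rewrite ltnn eqxx; case: odd.
Qed.

(** The offset [c p + 2] counts the letter [p], the stem and the bit. *)
Lemma emb_sim c z w k : sim k z w ->
  mkseq (emb c z) (k + (c z.1./2).+2) = mkseq (emb c w) (k + (c z.1./2).+2).
Proof.
case: z w => [q r] [q' r'] [/= <- /mkseqP rr']; apply/mkseqP => -[//|i] ik /=.
case: ltnP => // ci; case: eqP => // /eqP ne; apply: rr'.
have : (c q./2 < i)%N by rewrite ltn_neqAle eq_sym ne.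
by lia.
Qed.

Lemma sim_emb c z w k :
  mkseq (emb c z) (k + (c z.1./2).+2) = mkseq (emb c w) (k + (c z.1./2).+2) ->
  sim k z w.
Proof.
move=> /mkseqP zw; rewrite -(embK c z) -(embK c w).
have z0 : (emb c w 0 = z.1./2)%N by rewrite -zw ?addnS.
have zi i : (i < k + (c z.1./2).+2)%N -> emb c w i = emb c z i by move=> /zw.
rewrite /dec z0; have -> : emb c z 0%N = z.1./2 by [].
split; first by apply: (congr1 (addn z.1./2.*2)); apply/esym/zi; lia.
by apply/mkseqP => i ik; apply/esym/zi; lia.
Qed.

Lemma emb_stem c z w : z.1./2 = w.1./2 ->
  mkseq (emb c z) (c z.1./2).+1 = mkseq (emb c w) (c z.1./2).+1.
Proof. by move=> zw; apply/mkseqP => -[|i] /= ic; rewrite -zw// ltnS in ic *;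
  rewrite ic. Qed.

Lemma emb_bit c z : emb c z (c z.1./2).+1 = odd z.1.
Proof. by rewrite /= ltnn eqxx. Qed.

End coded_tree.

(** * Uniform homeomorphisms between bodies *)

Section unif_homeo.
Context (R : realType).

Lemma entourage_body (A : set (baire R)) (E : set (A * A)) :
  entourage E <-> exists n, forall x y : A,
    mkseq (val x) n = mkseq (val y) n -> E (x, y).
Proof.
split.
  move=> [V + VE]; rewrite -entourage_ballE => -[e /= e0 eV].
  have [n ne] := exp2V_lt e0; exists n.+1 => x y /mkseqP xy.
  apply: VE; apply: eV => /=; rewrite ballEmdist /=.
  by apply: lt_trans ne; apply/baire_dist_lt => m mn; exact: xy.
move=> [n nE]; exists [set xy : baire R * baire R | ball xy.1 (2 ^- n) xy.2].
  by rewrite -entourage_ballE; exists (2 ^- n) => //=;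
    rewrite invr_gt0 exprn_gt0.
move=> [x y] /=; rewrite ballEmdist /= => /baire_dist_lt xy; apply: nE.
by apply/mkseqP => i /ltnW /xy.
Qed.

Lemma unif_continuous_body (A B : set (baire R)) (f : A -> B) :
  unif_continuous f <-> forall m, exists d, forall x y : A,
    mkseq (val x) d = mkseq (val y) d ->
    mkseq (val (f x)) m = mkseq (val (f y)) m.
Proof.
split=> [uf m|fm E /entourage_body[m mE]].
  have /entourage_body[d dP] : entourage ((fun xy => (f xy.1, f xy.2)) @^-1`
      [set xy : B * B | mkseq (val xy.1) m = mkseq (val xy.2) m]).
    by apply: uf; apply/entourage_body; exists m.
  by exists d => x y /dP.
have [d dP] := fm m; apply/entourage_body; exists d => x y /dP; exact: mE.
Qed.

(** [c'] tends to infinity along every sequence of indices along which [c] does. *)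
Definition controls (c c' : nat -> nat) : Prop :=
  forall m, exists d, forall p, (d <= c p)%N -> (m <= c' p)%N.

Local Notation Tree c := (body R (ctree c)).

Lemma body_block_points c (x : Tree c) : block_points (dec c (val x)).
Proof. by have := valP x; rewrite inE => /body_ctree[]. Qed.

Lemma body_decK c (x : Tree c) : emb c (dec c (val x)) = val x.
Proof. by have := valP x; rewrite inE => /body_ctree[x0 xb _]; exact: decK. Qed.

Definition body_point c z (Sz : block_points z) : Tree c :=
  exist _ (emb c z) (mem_set (body_emb R c Sz)).

Definition restem c c' (x : Tree c) : Tree c' :=
  body_point c' (body_block_points x).

Lemma restemK c c' : cancel (@restem c c') (@restem c' c).
Proof. by move=> x; apply: val_inj; rewrite /= embK body_decK. Qed.

(** Over a stem of length at least [d], the new stem alone gives agreement to depth [m]; over a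
    shorter one, [m + d + 2] letters reach [m] letters into the block. *)
Lemma restem_unif_continuous c c' :
  controls c c' -> unif_continuous (@restem c c').
Proof.
move=> cc'; apply/unif_continuous_body => m; have [d dP] := cc' m.
exists (m + d.+2)%N => x y /=; rewrite -(body_decK x) -(body_decK y).
move: (dec c (val x)) (dec c (val y)) => z w; rewrite !embK => zw.
have [dc|cd] := leqP d (c z.1./2).
  have z0 : z.1./2 = w.1./2 by move/mkseqP: zw => /(_ 0%N); rewrite !addnS;
    exact.
  by apply: mkseq_le (emb_stem c' z0); rewrite ltnW// ltnS dP.
apply: mkseq_le (emb_sim c' (k := m) _); first exact: leq_addr.
by apply: (sim_emb (c := c)); apply: mkseq_le zw; rewrite leq_add2l !ltnS ltnW.
Qed.

(** [f] seen on the union of the blocks; outside [block_points], where [sim_homeo] asks nothing, the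
    identity is a default. *)
Definition induced c c' (f : Tree c -> Tree c') (z : nat * (nat -> nat)) :=
  if pselect (block_points z) is left Sz then dec c' (val (f (body_point c Sz)))
  else z.

Lemma inducedE c c' (f : Tree c -> Tree c') z (Sz : block_points z) :
  induced f z = dec c' (val (f (body_point c Sz))).
Proof.
rewrite /induced; case: pselect => // Sz'.
by congr (dec _ (val (f _))); apply: val_inj.
Qed.

Lemma induced_homeo c c' (f : Tree c -> Tree c') (g : Tree c' -> Tree c) :
  cancel f g -> unif_continuous f -> sim_homeo (induced f) (induced g).
Proof.
move=> fK /unif_continuous_body uf; split.
- by move=> z Sz; rewrite inducedE; exact: body_block_points.
- move=> z Sz; have Sfz := body_block_points (f (body_point c Sz)).
  rewrite (inducedE f Sz) (inducedE g Sfz).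
  have -> : body_point c' Sfz = f (body_point c Sz).
    by apply: val_inj; rewrite /= body_decK.
  by rewrite fK /= embK.
- move=> z Sz k; have [d dP] := uf (k + (c' (induced f z).1./2).+2)%N.
  exists d => w Sw zw; apply: (sim_emb (c := c')).
  move: dP; rewrite (inducedE f Sz) (inducedE f Sw) !body_decK; apply => /=.
  by apply: mkseq_le (emb_sim c zw); exact: leq_addr.
Qed.

(** Both base points over [p] are preserved. They agree on the stem of length [c p] and differ at
    the bit, so uniform continuity forces the stem of length [c' p] to be long when the first is. *)
Lemma unif_homeo_controls c c' (f : Tree c -> Tree c') (g : Tree c' -> Tree c) :
  cancel f g -> cancel g f -> unif_continuous f -> unif_continuous g ->
  controls c c'.
Proof.
move=> fK gK uf ug m; have hfg := induced_homeo fK uf;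
  have hgf := induced_homeo gK ug.
(* Depth [m + 2] includes the bit, at position [c' p + 1], whenever [c' p < m]. *)
have [d dP] := (unif_continuous_body f).1 uf m.+2.
exists d => p dp; rewrite leqNgt; apply/negP => pm.
have Sb q : block_points (base_point q) by have [] := marked_base_point q.
have fE q : val (f (body_point c (Sb q))) = emb c' (base_point q).
  have := base_point_rigid q hfg hgf; rewrite (inducedE f (Sb q)).
  by move=> /(congr1 (emb c')); rewrite body_decK.
have e1 : (base_point p.*2).1./2 = p by exact: doubleK.
have e2 : (base_point p.*2.+1).1./2 = p by exact: uphalf_double.
have agr : mkseq (emb c (base_point p.*2)) d =
    mkseq (emb c (base_point p.*2.+1)) d.
  apply: mkseq_le (emb_stem c (z := base_point p.*2) (w := base_point p.*2.+1)
    _).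
    by rewrite e1 ltnW.
  by rewrite e1 e2.
have /mkseqP := dP (body_point c (Sb p.*2)) (body_point c (Sb p.*2.+1)) agr.
move=> /(_ (c' p).+1 (leqW pm)); rewrite !fE.
have := emb_bit c' (base_point p.*2); rewrite e1 => ->.
have := emb_bit c' (base_point p.*2.+1); rewrite e2 => ->.
by rewrite /= odd_double.
Qed.

Lemma unif_homeomorphic_ctree c c' :
  unif_homeomorphic R (ctree_pruned c) (ctree_pruned c') <->
  controls c c' /\ controls c' c.
Proof.
split=> [[f [g [fK gK uf ug]]]|[cc' c'c]].
  by split; [exact: (unif_homeo_controls fK gK uf ug)|exact:
    (unif_homeo_controls gK fK ug uf)].
exists (@restem c c'), (@restem c' c).
by split; [exact: restemK|exact: restemK|exact: restem_unif_continuous|exact: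
  restem_unif_continuous].
Qed.

End unif_homeo.

(** * The Borel reduction of l_oo to uniform homeomorphism *)

Section linfty_reduction.
Context (R : realType).
Local Notation RS := {ptws nat -> R}.

(* [p] codes a pair of an index and an integer; for [x] and [y] at bounded
   distance all the [coef x p] and [coef y p] are within a common bound, and
   [coef y p] vanishes at the code of [(n, floor (y n))]. *)
Definition coef (x : RS) (p : nat) : nat :=
  if unpickle p is Some ni then `|Num.floor (x ni.1) - ni.2 : int|%N else 0%N.

Lemma linfty_controls (x y : RS) :
  linfty_equiv x y -> controls (coef x) (coef y).
Proof.
(* Reals less than [truncn M + 1] apart have floors less than [truncn M + 2] apart; a code of no
   pair has coefficient 0, below this bound. *)
move=> [M xyM] m; exists (m + (Num.truncn M).+2)%N => p; rewrite /coef.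
case: unpickle => [[n i]|]; last by lia.
have := truncnS_gt M; have := xyM n; rewrite ltr_norml => /andP[xy1 xy2] MS /=.
have /andP[fx1 fx2] := floor_itv (x n); have /andP[fy1 fy2] := floor_itv (y n).
have h1 : Num.floor (x n) - Num.floor (y n) < (Num.truncn M).+2%:Z.
  rewrite -(ltr_int R) rmorphB /= -pmulrn -natr1.
  move: fx1 fy2; rewrite rmorphD /=; lra.
have h2 : Num.floor (y n) - Num.floor (x n) < (Num.truncn M).+2%:Z.
  rewrite -(ltr_int R) rmorphB /= -pmulrn -natr1.
  move: fy1 fx2; rewrite rmorphD /=; lra.
by lia.
Qed.

Lemma controls_linfty (x y : RS) :
  controls (coef x) (coef y) -> linfty_equiv x y.
Proof.
move=> /(_ 1%N)[d dP]; exists d.+1%:R => n.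
(* Here [coef y] is 0, so [coef x], the distance between the floors, is less than [d]. *)
have := dP (pickle (n, Num.floor (y n))); rewrite /coef pickleK /= subrr.
move=> h.
have /andP[fx1 fx2] := floor_itv (x n); have /andP[fy1 fy2] := floor_itv (y n).
have h1 : Num.floor (x n) - Num.floor (y n) < d%:Z by lia.
have h2 : Num.floor (y n) - Num.floor (x n) < d%:Z by lia.
move: h1 h2; rewrite -!(ltr_int R) !rmorphB /= -pmulrn => h1 h2.
move: fx2 fy2; rewrite !rmorphD /= => fx2 fy2.
by rewrite ltr_norml -natr1; apply/andP; split; lra.
Qed.

Definition linfty_tree (x : real_sequences R) : pruned_trees :=
  ctree_pruned (coef x).

Lemma linfty_treeP (x y : real_sequences R) :
  linfty_equiv x y <-> unif_homeomorphic R (linfty_tree x) (linfty_tree y).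
Proof.
rewrite unif_homeomorphic_ctree; split=> [xy|[xy _]];
  last exact: controls_linfty.
split; apply: linfty_controls => //.
by have [M xyM] := xy; exists M => n; rewrite distrC.
Qed.

Lemma borel_floor n (k : int) : borel_set [set x : RS | Num.floor (x n) = k].
Proof.
have op (a : R) : open [set x : RS | x n < a].
  have /continuousP : continuous (fun x : RS => x n).
    exact: (@proj_continuous nat (fun=> R) n).
  by move=> /(_ [set t | t < a]); apply; exact: open_lt.
rewrite (_ : [set _ | _] = [set x : RS | x n < (k + 1)%:~R] `&` ~` [set x : RS
  | x n < k%:~R]).
  apply: borel_setI; first exact: open_borel_set.
  by apply: borel_setC; exact: open_borel_set.
apply/seteqP; split=> x /=.
  by move=> <-; split; [exact: floorD1_gt|apply/negP; rewrite -leNgt;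
    exact: floor_le].
by move=> [xk /negP]; rewrite -leNgt => kx; apply: floor_def; rewrite kx xk.
Qed.

Lemma borel_coef p k : borel_set [set x : RS | coef x p = k].
Proof.
rewrite /coef; case: unpickle => [[n i]|]; last first.
  exact: borel_set_const.
rewrite (_ : [set _ | _] = \bigcup_(z in [set z : int | `|z - i|%N = k])
    [set x : RS | Num.floor (x n) = z]).
  by apply: borel_set_bigcup => z; exact: borel_floor.
apply/seteqP; split=> [x /= xk|x [z /= zk xz]]; last by rewrite /= xz.
by exists (Num.floor (x n)).
Qed.

(** Membership of a word starting with [p] depends on the single value [coef x p], so the set is a
    countable union of Borel sets. *)
Lemma borel_ctree (s : seq nat) v :
  borel_set [set x : RS | nat_of_bool (ctree (coef x) s) = v].
Proof.
case: s => [|p t].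
  exact: (@borel_set_const RS (1%N = v)).
rewrite (_ : [set _ | _] = \bigcup_(k in [set k | nat_of_bool (ctree (fun=> k)
  (p :: t)) = v])
    [set x : RS | coef x p = k]).
  by apply: borel_set_bigcup => k; exact: borel_coef.
apply/seteqP; split=> [x /= xk|x [k /= kv xk]]; last by rewrite /= xk.
by exists (coef x p).
Qed.

Lemma linfty_tree_borel : borel_fun linfty_tree.
Proof.
apply: (@borel_fun_base _ _ _ (seq (seq nat * nat)) (fun w =>
    (val : pruned_trees -> {ptws seq nat -> bool}) @^-1`
      @cylinder (seq nat) bool nat_of_bool w)).
  move=> T V /nbhs_set_type[W TW WV].
  have [|w wT wW] := @cylinder_base (seq nat) bool nat_of_bool _ _ _ TW.
    by move=> [] [].
  by exists w => // S /wW /WV.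
move=> w.
rewrite (_ : _ @^-1` _ = \bigcap_(p in [set` w])
    [set x : RS | nat_of_bool (ctree (coef x) p.1) = p.2]).
  elim: w => [|p w IH].
    rewrite (_ : \bigcap_(_ in _) _ = setT); first by apply: open_borel_set;
      exact: openT.
    by apply/seteqP; split => // x _ p.
  rewrite (_ : \bigcap_(_ in _) _ = [set x : RS | nat_of_bool (ctree (coef x)
    p.1) = p.2] `&`
      \bigcap_(p in [set` w]) [set x : RS | nat_of_bool (ctree (coef x) p.1) =
        p.2]).
    by apply: borel_setI => //; exact: borel_ctree.
  apply/seteqP; split=> x /=.
    by move=> xw; split=> [|q qw]; apply: xw => /=; rewrite inE ?eqxx// qw orbT.
  by move=> [xp xw] q /=; rewrite inE => /orP[/eqP->//|/xw].
by apply/seteqP; split=> x xw p pw; exact: xw.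
Qed.

Lemma linfty_unif_homeomorphic :
  borel_reducible (@linfty_equiv R) (unif_homeomorphic R).
Proof. by exists linfty_tree;
  [exact: linfty_tree_borel|exact: linfty_treeP]. Qed.

End linfty_reduction.

Theorem theorem2p4 (R : realType) :
  [/\ borel_reducible (@linfty_equiv R) (unif_homeomorphic R),
      forall (G : topologicalGroupType) (X : topologicalType)
             (act : G -> X -> X),
        polish_space R G -> polish_space R X -> borel_action act ->
        ~ borel_reducible (unif_homeomorphic R) (orbit_equiv act)
    & ~ borel_reducible (unif_homeomorphic R) graph_iso].
Proof.
(* A reduction of uniform homeomorphism to an orbit relation would compose with this one to a
   reduction of [E1]. *)
have E1u := borel_reducible_trans (E1_linfty R) (linfty_unif_homeomorphic R).
have no_orbit (G : topologicalGroupType) (X : topologicalType) (act : G -> X ->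
  X) :
    polish_space R G -> polish_space R X -> borel_action act ->
    ~ borel_reducible (unif_homeomorphic R) (orbit_equiv act).
  move=> pG pX bact uo; apply: (E1_not_orbit pG pX bact).
  exact: borel_reducible_trans E1u uo.
split => //; first exact: linfty_unif_homeomorphic.
move=> [f bf fE].
(* Graph isomorphism is the orbit relation of the permutation group of [nat]. *)
apply: (no_orbit _ _ _ (polish_Sinf R) (polish_countable_graphs R)
  graph_act_borel).
by exists f => // T S; rewrite fE graph_iso_orbit.
Qed.
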